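(* For all integers $k,\Delta\ge 2$ and every real $\varrho>0$ there are $n_0$ and $\varepsilon_0>0$ such that the following holds for all $0<\varepsilon\le\varepsilon_0$. If $H$ is a $(\varrho,2,\varepsilon)$-typical $k$-graph on $n\ge n_0$ vertices, then $H$ contains every $k$-tree $T$ on $n$ vertices with $\Delta_1(T)\le\Delta$ as a subgraph.
   Context: A $k$-graph is a (finite) $k$-uniform hypergraph. For a $k$-graph $H$ and a set $F$ of distinct $(k-1)$-subsets of $V(H)$, the joint degree of $F$ is $\deg_H(F)=|\{v\in V(H): f\cup\{v\}\in H\text{ for each } f\in F\}|$. A $k$-graph $H$ on $n$ vertices is $(\varrho,h,\varepsilon)$-typical if $|\deg_H(F)-\varrho^{|F|}n|\le\varepsilon n$ for every set $F$ of $(k-1)$-subsets of $V(H)$ with $|F|\le h$. The maximum 1-degree $\Delta_1(T)$ is the maximum number $m$ such that some vertex of $T$ is contained in $m$ edges. A (tight) $k$-tree is a $k$-graph defined iteratively: a single $k$-uniform edge (on its $k$ vertices) is a $k$-tree; any $k$-graph obtained from a $k$-tree $T$ by adding a new vertex $v$ and a new edge $e$ such that $v\in e$ and $|e\cap e'|=k-1$ for some edge $e'\in E(T)$ is also a $k$-tree. *)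

(* Defs.v *)
From mathcomp Require Import all_boot all_order all_algebra.
From mathcomp Require Import reals.

Set Implicit Arguments.
Unset Strict Implicit.
Unset Printing Implicit Defensive.

Import Order.TTheory GRing.Theory Num.Theory.

(* The vertex set of a k-graph is the whole carrier type V. *)
Record kgraph (k : nat) (V : finType) := KGraph {
  edges : {set {set V}};
  edges_uniform : forall e, e \in edges -> #|e| = k
}.

Definition joint_degree (k : nat) (V : finType) (H : kgraph k V)
    (F : {set {set V}}) : nat :=
  #|[set v : V | [forall f in F, (v |: f) \in edges H]]|.

Local Open Scope ring_scope.

Definition typical (R : realType) (k : nat) (V : finType) (H : kgraph k V)
    (rho : R) (h : nat) (eps : R) : Prop :=
  forall F : {set {set V}},
    (forall f, f \in F -> #|f| = k.-1) -> (#|F| <= h)%N ->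
    `|(joint_degree H F)%:R - rho ^+ #|F| * #|V|%:R| <= eps * #|V|%:R.

Local Close Scope ring_scope.

Definition max_degree1 (k : nat) (V : finType) (T : kgraph k V) : nat :=
  \max_(v : V) #|[set e in edges T | v \in e]|.

(* [ktree_on k S E]: the hypergraph with vertex set S and edge set E is a
   k-tree. The set S grows along the construction, inside a fixed type V. *)
Inductive ktree_on (k : nat) (V : finType) :
    {set V} -> {set {set V}} -> Prop :=
| ktree_edge (e : {set V}) : #|e| = k -> ktree_on k e [set e]
| ktree_extend (S : {set V}) (E : {set {set V}}) (v : V) (e e' : {set V}) :
    ktree_on k S E ->
    v \notin S -> e \subset v |: S -> #|e| = k -> v \in e ->
    e' \in E -> #|e :&: e'| = k.-1 ->
    ktree_on k (v |: S) (e |: E).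

Definition is_ktree (k : nat) (V : finType) (T : kgraph k V) : Prop :=
  ktree_on k [set: V] (edges T).

(* H has a subgraph isomorphic to T. *)
Definition contains (k : nat) (V W : finType) (H : kgraph k V)
    (T : kgraph k W) : Prop :=
  exists2 phi : W -> V, injective phi &
    forall e, e \in edges T -> phi @: e \in edges H.

(* Main.v *)
Require Import Defs.
From mathcomp Require Import all_boot all_order all_algebra.
From mathcomp Require Import reals zify ring lra.

(* Write N(g) for the vertices completing a (k-1)-set g to an edge of H. The vertices of
   T are ordered so that each new one lies in a single edge, made with its k-1 parents.

   Gadgets. A vertex w of T all of whose edges are already embedded can be moved to an
   unused vertex u if u completes the link of w. A linear number of pairwise separated
   w, together with the youngest parent of w and the children of w, are embedded first,
   greedily. Given u and f, each vertex of such a block lands with probability bounded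
   below where it keeps u compatible with w (and w itself lands in N(f)): the condition
   is always membership in two sets N(g), N(g') simultaneously, which is why control of
   pairs of (k-1)-sets suffices. Derandomising with a product potential, every unused u
   and every f get linearly many w that u can replace, with the image of w in N(f).

   Almost spanning. By the second moment method, for every linear-size set U of unused
   vertices only boundedly many (k-1)-sets g have N(g) small on U. So one embeds
   a vertex whose parents have a large N(g) on U, avoiding the boundedly many choices
   that create a poor site. If all sites are poor there are boundedly many of them; while
   U shrinks by a constant factor, only these can require a swap with a gadget, since the
   sites created meanwhile stay rich. Hence boundedly many swaps are made in total until
   U is smaller than the number of gadgets, after which every vertex is embedded by a swap. *)

Set Implicit Arguments.
Unset Strict Implicit.
Unset Printing Implicit Defensive.

Import Order.TTheory GRing.Theory Num.Theory.

(** * Orderings of k-trees *)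

(** Base vertices share rank 0, so ranks separate only the later vertices. [par_tree] records
    tightness: the parents of a vertex all lie in one earlier edge. *)
Record tree_order (k : nat) (W : finType) (S : {set W}) (E : {set {set W}})
    (e0 : {set W}) (rk : W -> nat) (par : W -> {set W}) : Prop := TreeOrder {
  base_sub : e0 \subset S;
  card_base : #|e0| = k;
  rk_base : forall x, x \in e0 -> rk x = 0;
  rk_bounds : forall y, y \in S :\: e0 -> 0 < rk y < #|S|;
  rk_inj : {in S :\: e0 &, injective rk};
  par_sub : forall y, y \in S :\: e0 -> par y \subset S;
  card_par : forall y, y \in S :\: e0 -> #|par y| = k.-1;
  rk_par : forall y x, y \in S :\: e0 -> x \in par y -> rk x < rk y;
  tree_edges : E = e0 |: [set y |: par y | y in S :\: e0];
  par_tree : forall y, y \in S :\: e0 ->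
    par y \subset e0 \/
    exists2 y', y' \in S :\: e0 & rk y' < rk y /\ par y \subset y' |: par y'
}.

(** A new vertex [v] takes the current number of vertices as rank and [e :\ v] as parents. Since [v]
    is not in [e'], comparing sizes gives [e :&: e' = e :\ v], so the parents lie in [e']. *)
Lemma ktree_order (k : nat) (W : finType) (S : {set W}) (E : {set {set W}}) :
  0 < k -> ktree_on k S E -> exists e0 rk par, tree_order k S E e0 rk par.
Proof.
move=> k_gt0; elim=> [e ce|{}S {}E v e e' _ [e0 [rk [par to]]] vS eS ce ve e'E cee'].
  exists e, (fun=> 0), (fun=> set0); split=> //; rewrite ?setDv //.
  - by move=> y; rewrite inE.
  - by move=> y x; rewrite inE.
  - by move=> y; rewrite inE.
  - by move=> y; rewrite inE.
  - by move=> y x; rewrite inE.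
  - by rewrite imset0 setU0.
  - by move=> y; rewrite inE.
have bS := base_sub to.
have ve0 : v \notin e0 by apply: contra vS; apply: (subsetP bS).
have newS y : (y \in (v |: S) :\: e0) = (y == v) || (y \in S :\: e0).
  by rewrite !inE; case: eqP => //= ->; rewrite ve0.
have old y : y \in S :\: e0 -> (y == v) = false.
  by rewrite inE => /andP[_ yS]; apply/eqP => yv; rewrite -yv yS in vS.
have oldS y : y \in S -> (y == v) = false.
  by move=> yS; apply/eqP => yv; rewrite -yv yS in vS.
pose rk' y := if y == v then #|S| else rk y.
pose par' y := if y == v then e :\ v else par y.
have e'S : e' \subset S.
  move: e'E; rewrite (tree_edges to) => /setU1P[->//|/imsetP[y yS ->]].
  rewrite subUset sub1set (par_sub to yS) andbT.
  by move: yS; rewrite inE => /andP[].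
have evS : e :\ v \subset S.
  apply/subsetP => x; rewrite !inE => /andP[xv xe].
  by move/subsetP: eS => /(_ x xe); rewrite !inE (negPf xv).
have cev : #|e :\ v| = k.-1 by have := cardsD1 v e; rewrite ve ce; clear; lia.
have eve' : e :\ v \subset e'.
  have sub : e :&: e' \subset e :\ v.
    apply/subsetP => x; rewrite !inE => /andP[-> xe']; rewrite andbT.
    by rewrite oldS // (subsetP e'S).
  suff <- : e :&: e' = e :\ v by rewrite subsetIr.
  by apply/eqP; rewrite eqEcard sub cev cee' leqnn.
have S_gt0 : 0 < #|S|.
  have : #|e0| <= #|S| by apply: subset_leq_card.
  by rewrite (card_base to); apply: leq_trans.
have cvS : #|v |: S| = #|S|.+1 by rewrite cardsU1 vS.
have rk_lt x : x \in S -> rk x < #|S|.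
  move=> xS; case: (boolP (x \in e0)) => xe0; first by rewrite (rk_base to).
  by have /(rk_bounds to)/andP[] : x \in S :\: e0 by rewrite inE xe0.
exists e0, rk', par'; split.
- by rewrite (subset_trans bS) // subsetUr.
- exact: (card_base to).
- move=> x xe0; rewrite /rk' (rk_base to) //.
  by rewrite oldS // (subsetP bS).
- move=> y; rewrite newS /rk' cvS; case: eqP => [_ _|_ /= yS].
    by rewrite S_gt0 ltnSn.
  by have := rk_bounds to yS; clear; lia.
- move=> x y; rewrite !newS /rk'.
  case: eqP => [->|_] /=; case: eqP => [->|_] //= xS yS.
  + by have := rk_bounds to yS; clear; lia.
  + by have := rk_bounds to xS; clear; lia.
  + exact: (rk_inj to).
- move=> y; rewrite newS /par'; case: eqP => [_ _|_ /= yS].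
    by rewrite (subset_trans evS) // subsetUr.
  by rewrite (subset_trans (par_sub to yS)) // subsetUr.
- move=> y; rewrite newS /par'; case: eqP => [_ _//|_ /= yS].
  exact: (card_par to).
- move=> y x; rewrite newS /par' /rk'; case: eqP => [_ _|_ /= yS] xy.
    have xS : x \in S by apply: (subsetP evS).
    by rewrite oldS // rk_lt.
  rewrite oldS; first exact: (rk_par to).
  by apply: (subsetP (par_sub to yS)).
- rewrite (tree_edges to) setUCA; congr (_ |: _).
  apply/setP => f; apply/setU1P/imsetP.
    move=> [->|/imsetP[y yS ->]].
      by exists v; rewrite ?newS ?eqxx // /par' eqxx setD1K.
    by exists y; rewrite ?newS ?yS ?orbT // /par' old.
  move=> [y]; rewrite newS /par'; case: eqP => [-> _|_ /= yS] ->.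
    by left; rewrite setD1K.
  by right; apply/imsetP; exists y.
- move=> y; rewrite newS /par' /rk'; case: eqP => [_ _|_ /= yS].
    move: e'E; rewrite (tree_edges to) => /setU1P[<-|/imsetP[y1 y1S e'y]].
      by left.
    right; exists y1; first by rewrite newS y1S orbT.
    rewrite old // -e'y; split=> //; apply: rk_lt.
    by move: y1S; rewrite inE => /andP[].
  case: (par_tree to yS) => [->|[y' y'S [lt sub]]]; [by left|right].
  by exists y'; rewrite ?newS ?y'S ?orbT // old.
Qed.

(** * Separated blocks *)

Lemma card_bigcup_le (I T : finType) (A : {set I}) (F : I -> {set T}) b :
  (forall i, i \in A -> #|F i| <= b) -> #|\bigcup_(i in A) F i| <= #|A| * b.
Proof.
move=> Fb; apply: leq_trans (_ : \sum_(i in A) #|F i| <= _).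
  elim/big_rec2: _ => [|i m B _ le]; first by rewrite cards0.
  by rewrite (leq_trans (leq_card_setU _ _)) // leq_add2l.
by rewrite -sum_nat_const leq_sum.
Qed.

Lemma card_inj_interval (T : finType) (A : {set T}) (f : T -> nat) a b :
  {in A &, injective f} -> (forall x, x \in A -> a <= f x < a + b) -> #|A| <= b.
Proof.
move=> finj fab; rewrite cardE -(size_map f) -(size_iota a b).
apply: uniq_leq_size.
  rewrite map_inj_in_uniq ?enum_uniq // => x y.
  by rewrite !mem_enum => xA yA; apply: finj.
by move=> _ /mapP[x + ->]; rewrite mem_enum mem_iota => /fab.
Qed.

Section TreeOrder.

Variables (k Delta : nat) (W : finType) (E : {set {set W}}) (e0 : {set W}).
Variables (rk : W -> nat) (par : W -> {set W}).
Hypothesis k_ge2 : 1 < k.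
Hypothesis to : tree_order k [set: W] E e0 rk par.
Hypothesis degE : forall w, #|[set e in E | w \in e]| <= Delta.

Definition children (w : W) : {set W} := [set v | (v \notin e0) && (w \in par v)].

Definition down_closed (D : {set W}) : Prop :=
  e0 \subset D /\ forall y, y \in D -> y \notin e0 -> par y \subset D.

Let inT y : y \notin e0 -> y \in [set: W] :\: e0.
Proof. by rewrite !inE => ->. Qed.

Lemma parP x y : y \notin e0 -> x \in par y -> rk x < rk y.
Proof. by move/inT => ye0; apply: (rk_par to ye0). Qed.

Lemma notin_par y : y \notin e0 -> y \notin par y.
Proof. by move=> ye0; apply/negP => /(parP ye0); rewrite ltnn. Qed.

Lemma notin_children y : y \notin children y.
Proof. by rewrite inE; apply/negP => /andP[/notin_par/negP]. Qed.

Lemma card_parE y : y \notin e0 -> #|par y| = k.-1.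
Proof. by move/inT/(card_par to). Qed.

Lemma rk_injE : {in ~: e0 &, injective rk}.
Proof. by move=> x y; rewrite !inE => /inT + /inT; apply: (rk_inj to). Qed.

Lemma edge_par y : y \notin e0 -> y |: par y \in E.
Proof.
move=> ye0; rewrite (tree_edges to); apply/setU1P; right.
by apply/imsetP; exists y => //; apply: inT.
Qed.

(** Distinct children give distinct edges [v |: par v] through [w]: otherwise each of two vertices
    would be a parent of the other, against the ranks. *)
Lemma card_children w : #|children w| <= Delta.
Proof.
apply: leq_trans (degE w).
rewrite -(card_in_imset (f := fun v => v |: par v)) => [|v v'].
  apply: subset_leq_card; apply/subsetP => _ /imsetP[v + ->].
  by rewrite !inE => /andP[ve0 ->]; rewrite orbT andbT edge_par.
rewrite !inE => /andP[ve0 _] /andP[ve0' _] eq.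
have : v \in v' |: par v' by rewrite -eq setU11.
have : v' \in v |: par v by rewrite eq setU11.
case/setU1P => [->//|/(parP ve0) lt1] /setU1P[//|/(parP ve0') lt2].
by have := ltn_trans lt1 lt2; rewrite ltnn.
Qed.

Lemma low_closed m : 0 < m -> down_closed [set y | rk y < m].
Proof.
move=> m_gt0; split; first by apply/subsetP => x /(rk_base to); rewrite inE => ->.
move=> y; rewrite inE => ym ye0; apply/subsetP => x /(parP ye0).
by rewrite inE => /ltn_trans; apply.
Qed.

(** Ranks are injective outside [e0], so at most [#|W| - m] vertices have rank [m] or more, and at
    most [m] non-base vertices have a smaller one; the base adds [k]. *)
Lemma card_low m : 0 < m <= #|W| ->
  m <= #|[set y | rk y < m]| <= m + k.
Proof.
move=> /andP[m_gt0 mW]; set L := [set y | _]; have [sub _] := low_closed m_gt0.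
apply/andP; split.
  have : #|~: L| <= #|W| - m.
    apply: (@card_inj_interval _ _ rk m).
      have subC : ~: L \subset ~: e0 by rewrite setCS.
      by move=> x y xL yL; apply: rk_injE; apply: (subsetP subC).
    move=> x xL; have xe0 : x \notin e0.
      by apply: contraTN xL => /(subsetP sub); rewrite in_setC negbK.
    move: xL (rk_bounds to (inT xe0)); rewrite !inE cardsT; clear -mW; lia.
  have := cardsC L; clear -mW; lia.
rewrite -(setID L e0) (setIidPr sub) addnC (leq_trans (leq_card_setU _ _)) //.
rewrite (card_base to) leq_add2l.
apply: (@card_inj_interval _ _ rk 0) => [x y|x]; rewrite ?inE.
  by move=> /andP[? _] /andP[? _]; apply: rk_injE; rewrite inE.
by case/andP.
Qed.

Definition child_closure (D0 : {set W}) : {set W} := D0 :|: \bigcup_(w in D0) children w.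

(** One round of adding children suffices by tightness. If [w] in [D0] is a parent of [y] and
    [par y] lies in [y' |: par y'], then [w] is [y'] or a parent of [y']; so [y'] is in the closure,
    and induction on the rank applies to it. *)
Lemma child_closureP D0 : down_closed D0 -> down_closed (child_closure D0).
Proof.
move=> [sub cl]; have subD : D0 \subset child_closure D0 by apply: subsetUl.
split=> [|y]; first exact: subset_trans subD.
have [r] := ubnP (rk y); elim: r y => // r IH y /ltnSE yr yD ye0.
case: (boolP (y \in D0)) => yD0; first by rewrite (subset_trans (cl y yD0 ye0)).
move: yD; rewrite inE (negPf yD0) /= => /bigcupP[w wD0]; rewrite inE ye0 /= => wy.
case: (par_tree to (inT ye0)) => [pe0|[y' y'e [lt sub']]].
  by rewrite (subset_trans pe0) // (subset_trans sub).
have {}y'e : y' \notin e0 by move: y'e; rewrite !inE andbT.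
have y'D : y' \in child_closure D0.
  move/subsetP: sub' => /(_ w wy) /setU1P[<-|wy'].
    by apply: (subsetP subD).
  by rewrite inE; apply/orP; right; apply/bigcupP; exists w; rewrite // inE y'e.
rewrite (subset_trans sub') // subUset sub1set y'D /=.
by apply: IH => //; apply: leq_trans yr.
Qed.

Lemma card_child_closure D0 : #|child_closure D0| <= #|D0| * Delta.+1.
Proof.
rewrite (leq_trans (leq_card_setU _ _)) // mulnS leq_add2l.
by apply: card_bigcup_le => w _; apply: card_children.
Qed.

(* Junk value [w] if all the parents of [w] lie in [e0]. *)
Definition youngest (w : W) : W :=
  odflt w [pick z in par w | (z \notin e0) &&
    [forall x in par w, (x != z) ==> (rk x < rk z)]].

Lemma youngestP w : w \notin e0 -> ~~ (par w \subset e0) ->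
  [/\ youngest w \in par w, youngest w \notin e0 &
      forall x, x \in par w -> x != youngest w -> rk x < rk (youngest w)].
Proof.
move=> we0 /subsetPn[x0 x0w x0e]; rewrite /youngest; case: pickP => [z|none] /=.
  move=> /and3P[zw ze /forall_inP lt]; split=> // x xw xz.
  by have /implyP := lt x xw; apply.
case: (arg_maxnP rk x0w) => z zP zmax; have zw : z \in par w := zP.
have /negP := none z; case.
have ze : z \notin e0.
  apply/negP => /(rk_base to) z0; have := zmax _ x0w; rewrite z0.
  by have /andP[] := rk_bounds to (inT x0e); case: (rk x0).
rewrite zw ze; apply/forall_inP => x xw; apply/implyP => xz.
case: (boolP (x \in e0)) => xe.
  by rewrite (rk_base to xe); case/andP: (rk_bounds to (inT ze)).
rewrite ltn_neqAle [_ <= _](zmax x xw) andbT; apply: contra xz => /eqP eq.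
by apply/eqP/rk_injE; rewrite ?inE.
Qed.

(** These are the vertices at which the conditions for moving [w] get decided: [w] itself, its last
    parent (for the link in [w |: par w]) and its children (for the other edges through [w]). *)
Definition block (w : W) : {set W} := youngest w |: (w |: children w).

Lemma card_block w : #|block w| <= Delta.+2.
Proof.
rewrite !cardsU1; have := card_children w; clear.
by case: (_ \notin _); case: (_ \notin _) => /=; lia.
Qed.

(** [J] is a largest family of admissible vertices of rank below [m] with disjoint blocks. By
    maximality every admissible block meets a chosen one, and a vertex lies in boundedly many
    admissible blocks, so [J] is large. *)
Lemma disjoint_blocks m : 0 < m <= #|W| ->
  exists D J : {set W},
  [/\ down_closed D, #|D| <= (m + k) * Delta.+1,
      m <= #|J| * (Delta.+2 * (Delta + k).+1) + k * Delta.+1,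
      (forall w, w \in J -> [/\ w \notin e0, ~~ (par w \subset e0) & block w \subset D]) &
      {in J &, forall w w', w != w' -> [disjoint block w & block w']}].
Proof.
move=> mW; have m_gt0 : 0 < m by case/andP: mW.
pose L := [set y | rk y < m]; have Lcl : down_closed L := low_closed m_gt0.
have /andP[mL Lm] := card_low mW.
pose cand := [set w in L | (w \notin e0) && ~~ (par w \subset e0)].
pose dis (J : {set W}) := (J \subset cand) && [forall w in J, forall w' in J,
   (w != w') ==> [disjoint block w & block w']].
have dis0 : dis set0.
  by rewrite /dis sub0set; apply/forall_inP => w; rewrite inE.
case: (arg_maxnP (fun J : {set W} => #|J|) dis0) => J /andP[Jc /forall_inP Jd] Jmax.
have {}Jd : {in J &, forall w w', w != w' -> [disjoint block w & block w']}.
  by move=> w w' wJ w'J; have /forall_inP/(_ w' w'J)/implyP := Jd w wJ.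
exists (child_closure L), J; split=> //.
- exact: child_closureP.
- by rewrite (leq_trans (card_child_closure _)) // leq_mul2r Lm orbT.
(* If [y] lies in the block of [w], then [w] is [y], a child of [y] or a parent of [y]. *)
- pose touch y := [set w in cand | y \in block w].
  have touch_le y : #|touch y| <= (Delta + k).+1.
    have sub : touch y \subset [set y] :|: (children y :|: if y \in e0 then set0 else par y).
      apply/subsetP => w; rewrite 2!inE => /andP[/and3P[_ we0 /(youngestP we0)[zw ze _]]].
      rewrite !inE => /or3P[/eqP->|/eqP->|].
      + by rewrite we0 zw orbT.
      + by rewrite eqxx.
      + by move=> /andP[/negPf-> ->]; rewrite !orbT.
    apply: leq_trans (subset_leq_card sub) _.
    apply: leq_trans (leq_card_setU _ _) _; rewrite cards1 add1n ltnS.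
    apply: leq_trans (leq_card_setU _ _) _; rewrite leq_add ?card_children //.
    by case: ifP => [_|/negbT ye0]; rewrite ?cards0 // card_parE // leq_pred.
  have cand_le : #|cand| <= #|J| * (Delta.+2 * (Delta + k).+1).
    have sub : cand \subset \bigcup_(j in J) \bigcup_(y in block j) touch y.
      apply/subsetP => w wc.
      have wb : w \in block w by rewrite !inE eqxx orbT.
      suff [j jJ [y yj yw]] : exists2 j, j \in J & exists2 y, y \in block j & y \in block w.
        apply/bigcupP; exists j => //; apply/bigcupP; exists y => //.
        by rewrite inE wc.
      case: (boolP (w \in J)) => wJ; first by exists w => //; exists w.
      case: (boolP [exists j in J, ~~ [disjoint block j & block w]]).
        case/exists_inP => j jJ /pred0Pn[y] /= /andP[yj yw].
        by exists j => //; exists y.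
      rewrite negb_exists_in => /forall_inP far.
      have : dis (w |: J).
        rewrite /dis subUset sub1set wc Jc /=.
        apply/forall_inP => a aJ; apply/forall_inP => b bJ; apply/implyP => ab.
        case/setU1P: aJ => [aw|aJ]; case/setU1P: bJ => [bw|bJ].
        - by rewrite aw bw eqxx in ab.
        - by rewrite aw disjoint_sym -[[disjoint _ & _]]negbK far.
        - by rewrite bw -[[disjoint _ & _]]negbK far.
        - exact: Jd.
      by move/Jmax; rewrite cardsU1 wJ /= ltnn.
    apply: leq_trans (subset_leq_card sub) _; apply: card_bigcup_le => j _.
    apply: (@leq_trans (#|block j| * (Delta + k).+1)).
      by apply: card_bigcup_le.
    by rewrite leq_mul2r card_block orbT.
  (* Low vertices that are not candidates lie in the base or have all their parents there; the
     latter are children of base vertices, as [par w] is nonempty. *)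
  have sub : L \subset cand :|: (e0 :|: \bigcup_(x in e0) children x).
    apply/subsetP => w wL; rewrite !inE; move: wL; rewrite inE => ->.
    case: (boolP (w \in e0)) => we0 //=; case: (boolP (par w \subset e0)) => //= pe0.
    have /card_gt0P[x xw] : 0 < #|par w| by rewrite card_parE //; case: (k) k_ge2 => [|[]].
    by apply/bigcupP; exists x; [apply: (subsetP pe0)|rewrite inE we0].
  have bnd : #|L| <= #|cand| + k * Delta.+1.
    apply: leq_trans (subset_leq_card sub) _.
    apply: leq_trans (leq_card_setU _ _) _; rewrite leq_add2l mulnS.
    apply: leq_trans (leq_card_setU _ _) _; rewrite (card_base to) leq_add2l.
    rewrite -(card_base to); apply: card_bigcup_le => x _; exact: card_children.
  rewrite (leq_trans mL) // (leq_trans bnd) // leq_add2r //.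
- move=> w wJ; have := subsetP Jc w wJ; rewrite !inE => /and3P[wm we0 pw]; split=> //.
  have wL : w \in L by rewrite inE.
  have [zw _ _] := youngestP we0 pw.
  rewrite !subUset !sub1set (subsetP (subsetUl _ _) w wL) andTb.
  rewrite (subsetP (subsetUl _ _)) /=; last by apply: (subsetP (Lcl.2 w wL we0)).
  by rewrite (subset_trans _ (subsetUr _ _)) //; apply: bigcup_sup.
Qed.

End TreeOrder.

(** * Neighbourhoods in typical k-graphs *)

Local Open Scope ring_scope.

Definition nbh (k : nat) (V : finType) (H : kgraph k V) (g : {set V}) : {set V} :=
  [set v | (v |: g) \in edges H].

Lemma in_nbh (k : nat) (V : finType) (H : kgraph k V) g v :
  (v \in nbh H g) = (v |: g \in edges H).
Proof. by rewrite inE. Qed.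

Lemma sum_indicator (R : pzRingType) (T : finType) (A : {set T}) :
  \sum_x (x \in A)%:R = #|A|%:R :> R.
Proof.
rewrite -sum1_card natr_sum [RHS]big_mkcond /=.
by apply: eq_bigr => x _; case: (_ \in _).
Qed.

Section Typical.

Variables (R : realType) (k : nat) (V : finType) (H : kgraph k V) (rho eps : R).
Hypothesis typH : typical H rho 2 eps.
Hypothesis rho_gt0 : 0 < rho.

Let n : R := #|V|%:R.

Lemma nbh1 (g : {set V}) : #|g| = k.-1 -> `|#|nbh H g|%:R - rho * n| <= eps * n.
Proof.
move=> cg; have := typH (F := [set g]); rewrite cards1 expr1.
have -> : joint_degree H [set g] = #|nbh H g|.
  apply: eq_card => v; rewrite !inE; apply/forall_inP/idP => [|vg f].
    by apply; rewrite inE.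
  by rewrite inE => /eqP->.
by apply=> // f; rewrite inE => /eqP->.
Qed.

Lemma nbh2 (g g' : {set V}) : #|g| = k.-1 -> #|g'| = k.-1 -> g != g' ->
  `|#|nbh H g :&: nbh H g'|%:R - rho ^+ 2 * n| <= eps * n.
Proof.
move=> cg cg' gg'; have := typH (F := [set g; g']); rewrite cards2 gg'.
have -> : joint_degree H [set g; g'] = #|nbh H g :&: nbh H g'|.
  apply: eq_card => v; rewrite !inE; apply/forall_inP/andP => [all|[vg vg'] f].
    by rewrite !all // !inE eqxx ?orbT.
  by rewrite !inE => /orP[] /eqP->.
by apply=> // f; rewrite !inE => /orP[] /eqP->.
Qed.

(** The sets may coincide; then the degree is about [rho * n], and [rho <= 1] gives the same lower
    bound. *)
Lemma nbh2_ge (g g' : {set V}) : rho <= 1 -> #|g| = k.-1 -> #|g'| = k.-1 ->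
  (rho ^+ 2 - eps) * n <= #|nbh H g :&: nbh H g'|%:R.
Proof.
move=> rho_le1 cg cg'; have n_ge0 : 0 <= n by rewrite /n ler0n.
have [<-|gg'] := eqVneq g g'; last first.
  by have := nbh2 cg cg' gg'; rewrite ler_norml => /andP[+ _]; lra.
have := nbh1 cg; rewrite setIid ler_norml => /andP[+ _] => lo.
have : rho ^+ 2 * n <= rho * n by rewrite ler_wpM2r // expr2 ler_piMr // ltW.
by rewrite mulrBl; lra.
Qed.

(* Second moment of the number of members of [G] whose neighbourhood contains a given vertex. *)
Lemma few_poor (U : {set V}) (G : {set {set V}}) : rho <= 1 -> 0 < eps ->
  (forall g, g \in G -> #|g| = k.-1) ->
  (forall g, g \in G -> #|nbh H g :&: U|%:R <= rho / 2 * #|U|%:R) ->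
  rho ^+ 2 * (#|G| * #|U|)%:R <= 4 * (3 * eps * #|G|%:R + 1) * n.
Proof.
move=> rho_le1 eps_gt0 cG poor; have n_ge0 : 0 <= n by rewrite /n ler0n.
set K : R := #|G|%:R; have K_ge0 : 0 <= K by rewrite /K ler0n.
pose ind g v : R := (v \in nbh H g)%:R.
pose d v : R := \sum_(g in G) ind g v.
have sum_d : K * ((rho - eps) * n) <= \sum_v d v.
  rewrite exchange_big /= mulr_natl -sumr_const ler_sum // => g gG.
  by rewrite sum_indicator; have := nbh1 (cG g gG); rewrite ler_norml => /andP[+ _]; lra.
(* The extra [n] pays for the diagonal pair [g = g'], where only the trivial bound is used. *)
have sum_d2 : \sum_v d v ^+ 2 <= K * (K * ((rho ^+ 2 + eps) * n) + n).
  have -> : \sum_v d v ^+ 2 = \sum_(g in G) \sum_(g' in G) #|nbh H g :&: nbh H g'|%:R.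
    transitivity (\sum_v \sum_(g in G) \sum_(g' in G) (ind g v * ind g' v)).
      apply: eq_bigr => v _; rewrite expr2 mulr_suml; apply: eq_bigr => g _.
      by rewrite mulr_sumr.
    rewrite exchange_big; apply: eq_bigr => g _; rewrite exchange_big; apply: eq_bigr => g' _.
    rewrite -sum_indicator; apply: eq_bigr => v _.
    by rewrite /ind in_setI -natrM mulnb.
  rewrite mulr_natl -sumr_const ler_sum // => g gG.
  set A := (rho ^+ 2 + eps) * n.
  have A_ge0 : 0 <= A by rewrite mulr_ge0 // addr_ge0 ?sqr_ge0 // ltW.
  have -> : K * A + n = \sum_(g' in G) (A + (g == g')%:R * n).
    rewrite big_split /= sumr_const mulr_natl -mulr_suml (bigD1 g) //= eqxx.
    rewrite big1 ?addr0 ?mul1r // => g' /andP[_].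
    by rewrite eq_sym => /negPf->.
  rewrite ler_sum // => g' g'G.
  have [<-|gg'] := eqVneq g g'.
    have : #|nbh H g :&: nbh H g|%:R <= n by rewrite /n ler_nat max_card.
    by rewrite mul1r; lra.
  have := nbh2 (cG g gG) (cG g' g'G) gg'; rewrite ler_norml => /andP[_].
  by rewrite mul0r /A; lra.
have sum_U : \sum_(v in U) d v <= K * (rho / 2 * #|U|%:R).
  rewrite exchange_big /= mulr_natl -sumr_const ler_sum // => g gG.
  apply: le_trans (poor g gG); rewrite -sum_indicator big_mkcond /=.
  by apply: ler_sum => v _; rewrite in_setI andbC; case: (v \in U).
(* On [U] the mean of [d] is at most [rho * K / 2]. The quadratic is bounded below by an affine
   function of [d v], the difference being the square of [rho * K / 2 - d v]. *)
have lower : K ^+ 2 * rho ^+ 2 / 4 * #|U|%:R <= \sum_(v in U) (rho * K - d v) ^+ 2.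
  apply: (@le_trans _ _ (\sum_(v in U) (3 / 4 * rho ^+ 2 * K ^+ 2 - rho * K * d v))).
    rewrite sumrB sumr_const -[_ *+ #|U|]mulr_natr -[X in _ - X]mulr_sumr.
    have := ler_wpM2l (mulr_ge0 (ltW rho_gt0) K_ge0) sum_U.
    by lra.
  apply: ler_sum => v _; rewrite -subr_ge0.
  have -> : (rho * K - d v) ^+ 2 - (3 / 4 * rho ^+ 2 * K ^+ 2 - rho * K * d v)
     = (rho * K / 2 - d v) ^+ 2 by field.
  exact: sqr_ge0.
(* Over all of [V] the main terms [rho ^+ 2 * K ^+ 2 * n] cancel, leaving errors in [eps] and the
   diagonal contribution. *)
have upper : \sum_(v in U) (rho * K - d v) ^+ 2 <= 3 * eps * K ^+ 2 * n + K * n.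
  apply: (@le_trans _ _ (\sum_v (rho * K - d v) ^+ 2)).
    rewrite [leRHS](bigID (mem U)) /= lerDl sumr_ge0 // => v _; exact: sqr_ge0.
  have -> : \sum_v (rho * K - d v) ^+ 2
     = (rho * K) ^+ 2 * n - 2 * rho * K * (\sum_v d v) + \sum_v d v ^+ 2.
    rewrite mulr_sumr -sumrN [_ ^+ 2 * n]mulr_natr -sumr_const -!big_split /=.
    by apply: eq_bigr => v _; ring.
  have rK : 0 <= 2 * rho * K by rewrite !mulr_ge0 // ltW.
  have h1 := ler_wpM2l rK sum_d.
  have h2 : 2 * eps * K ^+ 2 * n * rho <= 2 * eps * K ^+ 2 * n.
    by rewrite ler_piMr // !mulr_ge0 ?sqr_ge0 // ltW.
  by lra.
have [K0|K_gt0] : K = 0 \/ 0 < K by move: K_ge0; rewrite le_eqVlt => /orP[/eqP|]; auto.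
  by rewrite natrM -/K K0 mul0r !mulr0 add0r mulr1 mulr_ge0.
rewrite -(ler_pM2l K_gt0) natrM -/K.
by have := le_trans lower upper; lra.
Qed.

End Typical.

(** * Gadgets *)

Lemma exists_le_mean (R : realFieldType) (T : finType) (A : {set T}) (F : T -> R) t :
  A != set0 -> \sum_(x in A) F x <= #|A|%:R * t -> exists2 x, x \in A & F x <= t.
Proof.
move=> /set0Pn[x0 x0A] le; case: (boolP [exists x in A, F x <= t]).
  by case/exists_inP => x; exists x.
rewrite negb_exists_in => /forall_inP gt; move: le; rewrite leNgt => /negP[].
rewrite mulr_natl -sumr_const; apply: ltr_sum => [|x /gt]; last by rewrite ltNge.
by apply/hasP; exists x0; rewrite ?mem_index_enum.
Qed.

(** * Partial embeddings and their extension by one vertex *)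

Section Embedding.

Variables (k : nat) (W V : finType) (H : kgraph k V) (E : {set {set W}}).
Variables (e0 : {set W}) (rk : W -> nat) (par : W -> {set W}).
Hypothesis k_ge2 : (1 < k)%N.
Hypothesis to : tree_order k [set: W] E e0 rk par.

(** [phi] is total, so that an extension is a pointwise update; for down-closed [D] only its values
    on [D] matter. *)
Definition embeds (D : {set W}) (phi : W -> V) : Prop :=
  [/\ {in D &, injective phi}, phi @: e0 \in edges H &
      forall y, y \in D -> y \notin e0 -> phi y |: phi @: par y \in edges H].

Definition upd (phi : W -> V) (y : W) (x : V) : W -> V :=
  fun v => if v == y then x else phi v.

Lemma updE phi y x : upd phi y x y = x.
Proof. by rewrite /upd eqxx. Qed.

Lemma upd_imset phi y x (A : {set W}) : y \notin A -> upd phi y x @: A = phi @: A.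
Proof.
move=> yA; apply: eq_in_imset => v vA; rewrite /upd.
by case: eqP => // vy; rewrite -vy vA in yA.
Qed.

Lemma upd_imsetU1 phi y x (A : {set W}) : y \notin A ->
  upd phi y x @: (y |: A) = x |: phi @: A.
Proof. by move=> yA; rewrite imsetU1 updE upd_imset. Qed.

Lemma down_closedU1 D y : down_closed e0 par D -> par y \subset D ->
  down_closed e0 par (y |: D).
Proof.
move=> [eD pD] py; split; first by rewrite (subset_trans eD) // subsetUr.
move=> v /setU1P[->|vD] ve0; last exact: subset_trans (pD v vD ve0) (subsetUr _ _).
exact: subset_trans py (subsetUr _ _).
Qed.

Lemma embeds_upd D phi y x : down_closed e0 par D -> embeds D phi ->
  y \notin D -> par y \subset D ->
  x \in nbh H (phi @: par y) -> x \notin phi @: D ->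
  embeds (y |: D) (upd phi y x).
Proof.
move=> [eD pD] [inj base edge] yD py; rewrite inE => xN xD.
have old v : v \in D -> (v == y) = false.
  by move=> vD; apply/eqP => vy; rewrite -vy vD in yD.
split.
- move=> u v /setU1P[->|uD] /setU1P[->|vD]; rewrite /upd ?eqxx ?old //.
  + by move=> xv; move: xD; rewrite xv imset_f.
  + by move=> xv; move: xD; rewrite -xv imset_f.
  + exact: inj.
- by rewrite upd_imset //; apply: contra yD; apply: (subsetP eD).
- move=> v /setU1P[->|vD] ve0.
    by rewrite updE upd_imset //; apply: contra yD; apply: (subsetP py).
  rewrite upd_imset; first by rewrite /upd old // edge.
  by apply: contra yD; apply: (subsetP (pD v vD ve0)).
Qed.

(* [w] can move its image to a vertex [u] outside the current image, and its old
   image then serves a vertex whose parents are mapped onto [f]. *)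
Definition swappable (u : V) (f : {set V}) (phi : W -> V) (w : W) : bool :=
  [&& phi w \in nbh H f, u |: phi @: par w \in edges H &
      [forall v in children e0 par w, u |: phi @: ((v |: par v) :\ w) \in edges H]].

(** [G] holds the gadgets not yet spent. By [st_children] no future edge contains a gadget. The
    bound [c] is uniform in [u] and [f], so plain extensions preserve it and a swap lowers it by at
    most one. *)
Record state (D : {set W}) (phi : W -> V) (G : {set W}) (c : nat) : Prop := State {
  st_closed : down_closed e0 par D;
  st_embeds : embeds D phi;
  st_sub : G \subset D;
  st_base : forall w, w \in G -> w \notin e0;
  st_children : forall w, w \in G -> children e0 par w \subset D;
  st_sep : {in G &, forall w w', w != w' ->
    [disjoint block e0 rk par w & block e0 rk par w']};
  st_count : forall u (f : {set V}), u \notin phi @: D -> #|f| = k.-1 ->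
    (c <= #|[set w in G | swappable u f phi w]|)%N
}.

(** * Derandomised greedy embedding of the gadget blocks *)

Section GreedyGadgets.

Variables (R : realType) (Delta : nat) (p : R) (D J : {set W}).
Hypothesis degE : forall w, (#|[set e in E | w \in e]| <= Delta)%N.
Hypothesis p_gt0 : 0 < p.
Hypothesis p_le1 : p <= 1.
Hypothesis V_gt0 : (0 < #|V|)%N.
Hypothesis Dcl : down_closed e0 par D.
Hypothesis Jblock : forall w, w \in J ->
  [/\ w \notin e0, ~~ (par w \subset e0) & block e0 rk par w \subset D].
Hypothesis Jdisj : {in J &, forall w w', w != w' ->
  [disjoint block e0 rk par w & block e0 rk par w']}.
Hypothesis nbh2_big : forall g g' : {set V}, #|g| = k.-1 -> #|g'| = k.-1 ->
  p * #|V|%:R + #|D|%:R <= #|nbh H g :&: nbh H g'|%:R.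

Local Notation blk := (block e0 rk par).
Local Notation young := (youngest e0 rk par).

(** Each edge condition in [swappable] is read at its last embedded vertex [y]; besides [u] and the
    image of [y], the edge consists of the images of these [k.-2] earlier vertices. *)
Definition dep (w y : W) : {set W} := if y == young w then par w :\ y else par y :\ w.

Definition test (q : V * {set V}) (w y : W) (phi : W -> V) : {set V} :=
  if y == w then q.2 else q.1 |: phi @: dep w y.

Definition pass (q : V * {set V}) (w : W) (phi : W -> V) (y : W) : bool :=
  phi y \in nbh H (test q w y phi).

(* An upper bound for the conditional expectation of 1/2 to the number of successes of the
   block: if it has not failed yet, it succeeds with probability at least [p] to the
   number of its missing vertices. *)
Definition weight q w (C : {set W}) phi : R :=
  if [forall y in blk w :&: C, pass q w phi y]
  then 1 - p ^+ #|blk w :\: C| / 2 else 1.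

Definition potential q (C : {set W}) phi : R :=
  if q.1 \in phi @: C then 0 else \prod_(w in J) weight q w C phi.

Definition keys : {set V * {set V}} := [set q : V * {set V} | #|q.2| == k.-1].

Definition total (C : {set W}) phi : R := \sum_(q in keys) potential q C phi.

Lemma weight_bounds q w C phi : 0 <= weight q w C phi <= 1.
Proof.
rewrite /weight; case: ifP => _; last by rewrite ler01 lexx.
have h1 : p ^+ #|blk w :\: C| <= 1 by rewrite exprn_ile1 // ltW.
have h0 : 0 <= p ^+ #|blk w :\: C| by rewrite exprn_ge0 // ltW.
by apply/andP; split; lra.
Qed.

Lemma potential_ge0 q C phi : 0 <= potential q C phi.
Proof.
rewrite /potential; case: ifP => // _; apply: prodr_ge0 => w _.
by case/andP: (weight_bounds q w C phi).
Qed.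

Lemma in_block w y : w \in J -> y \in blk w ->
  [\/ y = young w, y = w | [/\ y \notin e0, w \in par y, y != w & y != young w]].
Proof.
move=> wJ; have [we0 pw _] := Jblock wJ; have [zw ze0 zmax] := youngestP to we0 pw.
rewrite !inE => /or3P[/eqP|/eqP|/andP[ye0 wy]]; [by constructor 1|by constructor 2|].
have lt1 := parP to ye0 wy; have lt2 := parP to we0 zw.
constructor 3; split=> //; apply/eqP => eq; first by rewrite eq ltnn in lt1.
by have := ltn_trans lt2 lt1; rewrite eq ltnn.
Qed.

Lemma block_notin_base w y : w \in J -> y \in blk w -> y \notin e0.
Proof.
move=> wJ /(in_block wJ); have [we0 pw _] := Jblock wJ.
by have [zw ze0 zmax] := youngestP to we0 pw; case=> [->|->|[]].
Qed.

Lemma depP w y : w \in J -> y \in blk w -> y != w ->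
  #|dep w y| = k.-2 /\ forall x, x \in dep w y -> x \in D /\ (rk x < rk y)%N.
Proof.
move=> wJ yb yw; have [we0 pw bD] := Jblock wJ.
have [zw ze0 zmax] := youngestP to we0 pw.
have wD : w \in D by apply: (subsetP bD); rewrite !inE eqxx orbT.
have yD : y \in D by apply: (subsetP bD).
rewrite /dep; case: (in_block wJ yb) => [yz|yw'|[ye0 wy _ /negPf->]].
- rewrite yz eqxx; split=> [|x]; last first.
    rewrite in_setD1 => /andP[xz xw]; split; last exact: zmax.
    exact: (subsetP (Dcl.2 w wD we0)).
  by have := cardsD1 (young w) (par w); rewrite zw (card_parE to we0); case: (k) => [|[]] //= k' [].
- by rewrite yw' eqxx in yw.
- split=> [|x]; last first.
    rewrite in_setD1 => /andP[_ xy]; split; last exact: (parP to).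
    exact: (subsetP (Dcl.2 y yD ye0)).
  by have := cardsD1 w (par y); rewrite wy (card_parE to ye0); case: (k) => [|[]] //= k' [].
Qed.

(** * One greedy step, at the missing vertex of least rank *)

Section Step.

Variables (C : {set W}) (phi : W -> V) (y : W).
Hypothesis CD : C \subset D.
Hypothesis Ccl : down_closed e0 par C.
Hypothesis Cemb : embeds C phi.
Hypothesis Cinit : forall x v, x \in C -> v \in D :\: C -> (rk x < rk v)%N.
Hypothesis yDC : y \in D :\: C.
Hypothesis ymin : forall v, v \in D :\: C -> (rk y <= rk v)%N.

Let A := nbh H (phi @: par y) :\: phi @: C.

Let yC : y \notin C. Proof. by case/setDP: yDC. Qed.
Let yD : y \in D. Proof. by case/setDP: yDC. Qed.
Let ye0 : y \notin e0.
Proof. by apply: contra yC; apply: (subsetP Ccl.1). Qed.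

Lemma earlier_in x : x \in D -> (rk x < rk y)%N -> x \in C.
Proof.
move=> xD lt; apply: contraTT lt => xC; rewrite -leqNgt ymin //.
by rewrite inE xC.
Qed.

Lemma par_in : par y \subset C.
Proof.
apply/subsetP => x xy; apply: earlier_in; last exact: (parP to).
exact: (subsetP (Dcl.2 y yD ye0)).
Qed.

Lemma card_img_par : #|phi @: par y| = k.-1.
Proof.
rewrite card_in_imset ?(card_parE to) // => u v uy vy.
by case: Cemb => inj _ _; apply: inj; apply: (subsetP par_in).
Qed.

(** The test at [v] reads only [v] and vertices of smaller rank, all different from [y]. *)
Lemma pass_old q w x v : w \in J -> v \in blk w -> v \in C ->
  pass q w (upd phi y x) v = pass q w phi v.
Proof.
move=> wJ vb vC; rewrite /pass /test {1}/upd.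
have -> : (v == y) = false by apply/eqP => vy; have := yC; rewrite -vy vC.
case: eqVneq => // vw; rewrite upd_imset //.
apply/negP => /((depP wJ vb vw).2)[_ lt].
by have := ltn_trans lt (Cinit vC yDC); rewrite ltnn.
Qed.

Lemma pass_new q w x : w \in J -> y \in blk w ->
  pass q w (upd phi y x) y = (x \in nbh H (test q w y phi)).
Proof.
move=> wJ yb; rewrite /pass updE /test; case: eqVneq => // yw.
rewrite upd_imset //; apply/negP => /((depP wJ yb yw).2)[_].
by rewrite ltnn.
Qed.

Lemma weight_other q w x : w \in J -> y \notin blk w ->
  weight q w (y |: C) (upd phi y x) = weight q w C phi.
Proof.
move=> wJ yb; rewrite /weight.
have -> : blk w :\: (y |: C) = blk w :\: C.
  apply/setP => v; rewrite !in_setD in_setU1; case: eqP => //= ->.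
  by rewrite (negPf yb) andbF.
have -> // : [forall v in blk w :&: (y |: C), pass q w (upd phi y x) v] =
          [forall v in blk w :&: C, pass q w phi v].
apply/forall_inP/forall_inP => all v; rewrite !in_setI => /andP[vb vC].
  by rewrite -(pass_old q x wJ) // all // in_setI vb in_setU1 vC orbT.
case/setU1P: vC => [vy|vC]; first by rewrite -vy vb in yb.
by rewrite pass_old // all // in_setI vb.
Qed.

Lemma card_test q w : q \in keys -> q.1 \notin phi @: C -> w \in J -> y \in blk w ->
  #|test q w y phi| = k.-1.
Proof.
rewrite inE => /eqP cq qC wJ yb; rewrite /test; case: eqVneq => // yw.
have [cd dsub] := depP wJ yb yw.
have depC : dep w y \subset C by apply/subsetP => x /dsub[]; apply: earlier_in.
rewrite cardsU1 card_in_imset => [|u v ud vd]; last first.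
  by case: Cemb => inj _ _; apply: inj; apply: (subsetP depC).
rewrite cd; have -> : q.1 \notin phi @: dep w y.
  by apply: contra qC; apply: (subsetP (imsetS _ depC)).
by case: (k) k_ge2 => [|[]].
Qed.

(** Embedding [y] and passing a test ask for membership in two neighbourhoods at once; the term
    [#|D|] in [nbh2_big] absorbs the occupied vertices. *)
Lemma many_choices (g : {set V}) : #|g| = k.-1 -> p * #|A|%:R <= #|A :&: nbh H g|%:R.
Proof.
move=> cg; have h := nbh2_big card_img_par cg.
have le1 : p * #|A|%:R <= p * #|V|%:R by rewrite ler_wpM2l ?(ltW p_gt0) // ler_nat max_card.
have le2 : (#|nbh H (phi @: par y) :&: nbh H g| <= #|A :&: nbh H g| + #|D|)%N.
  have sub : nbh H (phi @: par y) :&: nbh H g \subset (A :&: nbh H g) :|: phi @: C.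
    apply/subsetP => x /setIP[x1 x2]; rewrite in_setU in_setI x2 in_setD x1 !andbT.
    by rewrite orNb.
  apply: leq_trans (subset_leq_card sub) _; apply: leq_trans (leq_card_setU _ _) _.
  by rewrite leq_add2l (leq_trans (leq_imset_card _ _)) // subset_leq_card.
rewrite -(ler_nat R) natrD in le2; lra.
Qed.

Lemma A_neq0 : A != set0.
Proof.
have h := nbh2_big card_img_par card_img_par; rewrite setIid in h.
have pV : 0 < p * #|V|%:R by rewrite mulr_gt0 // ltr0n.
apply: contraTneq h => A0; rewrite -ltNge.
have : (#|nbh H (phi @: par y)| <= #|D|)%N.
  apply: (@leq_trans #|phi @: C|); last first.
    by rewrite (leq_trans (leq_imset_card _ _)) // subset_leq_card.
  by rewrite subset_leq_card // -setD_eq0 -/A A0.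
rewrite -(ler_nat R); lra.
Qed.

(** A failed block already has the maximal weight 1. Otherwise a proportion at least [p] of the
    choices passes and gets weight [1 - p ^+ r / 2], the others at most 1, so the mean is at most
    [1 - p ^+ r.+1 / 2]. *)
Lemma weight_step q w : q \in keys -> q.1 \notin phi @: C -> w \in J -> y \in blk w ->
  \sum_(x in A) weight q w (y |: C) (upd phi y x) <= #|A|%:R * weight q w C phi.
Proof.
move=> qK qC wJ yb; rewrite {2}/weight; case: ifP => [all|_]; last first.
  rewrite mulr_natl -sumr_const; apply: ler_sum => x _.
  by case/andP: (weight_bounds q w (y |: C) (upd phi y x)).
set N := nbh H (test q w y phi).
set r := #|blk w :\: (y |: C)|.
have -> : #|blk w :\: C| = r.+1.
  rewrite /r (cardsD1 y (blk w :\: C)) in_setD yb yC /= add1n; congr (#|pred_of_set _|.+1).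
  by apply/setP => v; rewrite !in_setD in_setU1 in_set1 negb_or andbA.
have small x : x \in A :&: N -> weight q w (y |: C) (upd phi y x) = 1 - p ^+ r / 2.
  move=> /setIP[_ xN]; rewrite /weight; case: ifP => // /negbT.
  rewrite negb_forall_in => /exists_inP[v /setIP[vb /setU1P[->|vC]]].
    by rewrite pass_new // xN.
  by rewrite pass_old // (forall_inP all) // in_setI vb.
have -> : \sum_(x in A) weight q w (y |: C) (upd phi y x) =
   \sum_(x in A :&: N) weight q w (y |: C) (upd phi y x) +
   \sum_(x in A :\: N) weight q w (y |: C) (upd phi y x) by rewrite (big_setID N).
have le1 : \sum_(x in A :&: N) weight q w (y |: C) (upd phi y x)
   <= #|A :&: N|%:R * (1 - p ^+ r / 2).
  by rewrite mulr_natl -sumr_const; apply: ler_sum => x /small->.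
have le2 : \sum_(x in A :\: N) weight q w (y |: C) (upd phi y x) <= #|A :\: N|%:R * 1.
  rewrite mulr_natl -sumr_const; apply: ler_sum => x _.
  by case/andP: (weight_bounds q w (y |: C) (upd phi y x)).
have cA : #|A|%:R = #|A :&: N|%:R + #|A :\: N|%:R :> R by rewrite -natrD cardsID.
have many := many_choices (card_test qK qC wJ yb).
have pr : 0 <= p ^+ r by rewrite exprn_ge0 // ltW.
have := ler_wpM2r pr many; rewrite -/N exprS; lra.
Qed.

(** Blocks being disjoint, [y] affects at most one factor of the product. *)
Lemma potential_step q : q \in keys ->
  \sum_(x in A) potential q (y |: C) (upd phi y x) <= #|A|%:R * potential q C phi.
Proof.
move=> qK; rewrite {2}/potential; case: ifPn => qC.
  rewrite mulr0 big1 // => x _; rewrite /potential upd_imsetU1 // in_setU1 qC orbT //.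
apply: (@le_trans _ _ (\sum_(x in A) \prod_(w in J) weight q w (y |: C) (upd phi y x))).
  apply: ler_sum => x _; rewrite /potential; case: ifP => // _.
  by apply: prodr_ge0 => w _; case/andP: (weight_bounds q w (y |: C) (upd phi y x)).
case: (boolP [exists w in J, y \in blk w]) => [/exists_inP[w wJ yb]|].
  have -> : \sum_(x in A) \prod_(w in J) weight q w (y |: C) (upd phi y x) =
     (\sum_(x in A) weight q w (y |: C) (upd phi y x)) *
       \prod_(w' in J | w' != w) weight q w' C phi.
    rewrite mulr_suml; apply: eq_bigr => x _; rewrite (bigD1 w) //=; congr (_ * _).
    apply: eq_bigr => w' /andP[w'J w'w]; apply: weight_other => //.
    by apply/negP => yb'; have /disjointFr := Jdisj w'J wJ w'w => /(_ _ yb'); rewrite yb.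
  rewrite [X in _ <= _ * X](bigD1 w) //= mulrA ler_wpM2r ?weight_step //.
  by apply: prodr_ge0 => w' _; case/andP: (weight_bounds q w' C phi).
rewrite negb_exists_in => /forall_inP none.
rewrite mulr_natl -sumr_const; apply: ler_sum => x _.
by under eq_bigr => w wJ do rewrite (weight_other _ _ wJ (none w wJ)).
Qed.

Lemma greedy_step : exists x, [/\ x \in nbh H (phi @: par y), x \notin phi @: C &
  total (y |: C) (upd phi y x) <= total C phi].
Proof.
have [|x /setDP[xN xC] le] := @exists_le_mean _ _ A (fun x => total (y |: C) (upd phi y x))
    (total C phi) A_neq0; last by exists x.
rewrite exchange_big mulr_sumr; apply: ler_sum => q; exact: potential_step.
Qed.

End Step.

Lemma greedy_gadgets phi0 : embeds e0 phi0 ->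
  exists2 phi, embeds D phi & total D phi <= total e0 phi0.
Proof.
move=> emb0.
(* Vertices are added by increasing rank, so [C] stays an initial segment of [D] and tests refer to
   placed vertices. *)
suff gen m : forall C phi, #|D :\: C| = m -> C \subset D -> down_closed e0 par C ->
    embeds C phi -> (forall x v, x \in C -> v \in D :\: C -> (rk x < rk v)%N) ->
    exists2 phi', embeds D phi' & total D phi' <= total C phi.
  apply: (gen _ e0 phi0 erefl) => //; first exact: Dcl.1.
    by split=> // y ye0; rewrite ye0.
  move=> x v xe0 /setDP[_ ve0]; rewrite (rk_base to xe0).
  by have /(rk_bounds to)/andP[] : v \in [set: W] :\: e0 by rewrite !inE ve0.
elim: m => [|m IH] C phi cm CD Ccl Cemb Cinit.
  have DC : D \subset C by rewrite -setD_eq0 (cards0_eq cm).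
  have -> : D = C by apply/eqP; rewrite eqEsubset DC.
  by exists phi.
have /card_gt0P[y0 y0DC] : (0 < #|D :\: C|)%N by rewrite cm.
case: (arg_minnP rk y0DC) => y yP ymin; have yDC : y \in D :\: C := yP.
have yC : y \notin C by case/setDP: yDC.
have yD : y \in D by case/setDP: yDC.
have ye0 : y \notin e0 by apply: contra yC; apply: (subsetP Ccl.1).
have [x [xN xC le]] := greedy_step CD Ccl Cemb Cinit yDC ymin.
have [|||||phi' emb' le'] := IH (y |: C) (upd phi y x).
- have := cardsD1 y (D :\: C); rewrite cm yDC add1n => -[->].
  by congr #|pred_of_set _|; apply/setP => v; rewrite !inE negb_or andbA.
- by rewrite subUset sub1set yD.
- by apply: down_closedU1 => //; apply: (par_in Ccl yDC ymin).
- by apply: embeds_upd => //; apply: (par_in Ccl yDC ymin).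
- move=> u v /setU1P[->|uC] /setDP[vD]; rewrite in_setU1 negb_or => /andP[vy vC].
    have vDC : v \in D :\: C by rewrite in_setD vC.
    rewrite ltn_neqAle [(_ <= _)%N](ymin v vDC) andbT; apply: contra vy => /eqP eq.
    apply/eqP; apply: (rk_injE to); rewrite ?in_setC //.
    by apply: contra vC; apply: (subsetP Ccl.1).
  by apply: Cinit => //; rewrite in_setD vC.
- by exists phi' => //; apply: le_trans le.
Qed.

(** Blocks avoid the base, so no test has been made yet and each block misses at most [Delta.+2]
    vertices. *)
Lemma total_start phi0 : embeds e0 phi0 ->
  total e0 phi0 <= #|keys|%:R * (1 - p ^+ Delta.+2 / 2) ^+ #|J|.
Proof.
move=> emb; rewrite mulr_natl -sumr_const; apply: ler_sum => q _.
have a_ge0 : 0 <= 1 - p ^+ Delta.+2 / 2.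
  have : p ^+ Delta.+2 <= 1 by rewrite exprn_ile1 // ltW.
  lra.
rewrite /potential; case: ifP => _; first exact: exprn_ge0.
rewrite -prodr_const; apply: ler_prod => w wJ.
case/andP: (weight_bounds q w e0 phi0) => -> _ /=; rewrite /weight ifT.
  rewrite lerD2l lerN2 ler_wpM2r ?invr_ge0 //; apply: ler_wiXn2l => //; first exact: ltW.
  by apply: leq_trans (subset_leq_card (subsetDl _ _)) _; apply: card_block to degE _.
apply/forall_inP => v /setIP[vb ve0].
by have := block_notin_base wJ vb; rewrite ve0.
Qed.

Lemma swappable_pass u f phi w : w \in J ->
  (forall y, y \in blk w -> pass (u, f) w phi y) -> swappable u f phi w.
Proof.
move=> wJ all; have [we0 pw _] := Jblock wJ; have [zw ze0 zmax] := youngestP to we0 pw.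
apply/and3P; split.
- by have := all w; rewrite /pass /test eqxx; apply; rewrite !inE eqxx orbT.
- have := all (young w); rewrite /pass /test /dep eqxx.
  have -> : (young w == w) = false.
    by apply/eqP => eq; have := notin_par to we0; rewrite -{1}eq zw.
  rewrite in_nbh setUCA -imsetU1 setD1K //; apply; by rewrite !inE eqxx.
- apply/forall_inP => v vw; have vb : v \in blk w by rewrite !in_setU vw !orbT.
  have := all v vb; case: (in_block wJ vb) => [vz|vw'|[ve0 wv vw' vz]].
  + have := parP to we0 zw; move: vw; rewrite inE vz => /andP[ze /(parP to ze)] lt1 lt2.
    by have := ltn_trans lt1 lt2; rewrite ltnn.
  + by move: vw; rewrite vw' (negPf (notin_children to w)).
  rewrite /pass /test /dep (negPf vw') (negPf vz) in_nbh setUCA -imsetU1.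
  suff -> : (v |: par v) :\ w = v |: (par v :\ w) by [].
  by apply/setP => x; rewrite !inE; case: (eqVneq x v) => //= ->; rewrite vw'.
Qed.

Lemma greedy_state phi0 c : embeds e0 phi0 ->
  #|keys|%:R * (1 - p ^+ Delta.+2 / 2) ^+ #|J| < (1 / 2) ^+ c ->
  exists phi, state D phi J c.
Proof.
move=> emb0 small; have [phi emb le] := greedy_gadgets emb0; exists phi.
have subD w : w \in J -> blk w \subset D by move=> /Jblock[].
split=> //.
- by apply/subsetP => w /subD/subsetP; apply; rewrite !inE eqxx orbT.
- by move=> w /Jblock[].
- move=> w /subD; apply: subset_trans.
  by rewrite (subset_trans _ (subsetUr _ _)) // subsetUr.
move=> u f uD cf; set S := [set w in J | _].
have qK : (u, f) \in keys by rewrite inE cf.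
have : potential (u, f) D phi < (1 / 2) ^+ c.
  apply: le_lt_trans (le_lt_trans (le_trans le (total_start emb0)) small).
  rewrite /total (bigD1 (u, f)) //= lerDl; apply: sumr_ge0 => q _.
  exact: potential_ge0.
rewrite /potential /= (negPf uD) => lt; rewrite leqNgt; apply/negP => Sc.
move: lt; rewrite ltNge => /negP; apply.
apply: (@le_trans _ _ ((1 / 2) ^+ #|S|)).
  by apply: ler_wiXn2l; [lra|lra|exact: ltnW].
have -> : (1 / 2 : R) ^+ #|S| = \prod_(w in J) (if w \in S then 1 / 2 else 1).
  rewrite -prodr_const -big_mkcondr /=; apply: eq_bigl => w.
  by rewrite inE andbA andbb.
apply: ler_prod => w wJ; apply/andP; split; first by case: ifP => _; lra.
rewrite /weight.
have -> : blk w :\: D = set0 by apply/eqP; rewrite setD_eq0 subD.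
rewrite cards0 expr0; case: ifPn => wS; case: ifPn => [/forall_inP all|_]; try lra.
case/negP: wS; rewrite inE wJ swappable_pass //.
by move=> y yb; apply: all; rewrite in_setI yb; apply: (subsetP (subD w wJ)).
Qed.

End GreedyGadgets.
End Embedding.

(** * Completing the embedding *)

Section Completion.

Variables (k : nat) (W V : finType) (H : kgraph k V) (E : {set {set W}}).
Variables (e0 : {set W}) (rk : W -> nat) (par : W -> {set W}).
Hypothesis k_ge2 : (1 < k)%N.
Hypothesis to : tree_order k [set: W] E e0 rk par.

Local Notation blk := (block e0 rk par).
Local Notation state := (state H e0 rk par).
Local Notation kids := (children e0 par).
Local Notation swappable := (swappable H e0 par).

Definition unused (D : {set W}) (phi : W -> V) : {set V} := ~: (phi @: D).

(** The open sites. From here on any of them may be served next, regardless of rank. *)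
Definition ready (D : {set W}) : {set W} := [set y | (y \notin D) && (par y \subset D)].

Lemma state_le D phi G c c' : (c' <= c)%N -> state D phi G c -> state D phi G c'.
Proof.
move=> le [cl emb sub base kid sep cnt]; split=> // u f uD cf.
exact: leq_trans le (cnt u f uD cf).
Qed.

Lemma card_unused D phi G c : state D phi G c -> (#|unused D phi| + #|D|)%N = #|V|.
Proof.
move=> st; case: (st_embeds st) => inj _ _.
by rewrite -(card_in_imset inj) addnC cardsC.
Qed.

Lemma ready_notin_base D y : down_closed e0 par D -> y \in ready D -> y \notin e0.
Proof. by move=> [eD _]; rewrite inE => /andP[+ _]; apply: contra; apply: (subsetP eD). Qed.

Lemma ready_neq0 D : down_closed e0 par D -> D != [set: W] -> exists y, y \in ready D.
Proof.
move=> [eD pD]; rewrite -subTset => /subsetPn[y0 _ y0D].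
have y0C : y0 \in ~: D by rewrite inE.
case: (arg_minnP rk y0C) => y yP ymin; have {yP} : y \in ~: D := yP.
rewrite inE => yD; exists y; rewrite inE yD; apply/subsetP => x xy.
have ye0 : y \notin e0 by apply: contra yD; apply: (subsetP eD).
have := parP to ye0 xy; apply: contraTT => xD; rewrite -leqNgt.
by apply: ymin; have : x \in ~: D by rewrite inE.
Qed.

Lemma swappable_ext phi phi' u f w : phi' w = phi w -> {in par w, phi' =1 phi} ->
  (forall v, v \in kids w -> {in (v |: par v) :\ w, phi' =1 phi}) ->
  swappable u f phi' w = swappable u f phi w.
Proof.
move=> ew epar ekids; rewrite /swappable ew (eq_in_imset epar).
congr [&& _, _ & _]; apply/forall_inP/forall_inP => all v vw.
  by rewrite -(eq_in_imset (ekids v vw)) all.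
by rewrite (eq_in_imset (ekids v vw)) all.
Qed.

(** The children of a gadget are all embedded; hence moving a gadget never changes the parent image
    of an open site. *)
Lemma ready_par_gadget D phi G c w v : state D phi G c -> w \in G ->
  v \notin D -> w \notin par v.
Proof.
move=> st wG vD; have [eD _] := st_closed st.
have ve0 : v \notin e0 by apply: contra vD; apply: (subsetP eD).
by apply: contra vD => wv; apply: (subsetP (st_children st wG)); rewrite inE ve0.
Qed.

Lemma gadget_link D phi G c w : state D phi G c -> w \in G ->
  [/\ w \in D, par w \subset D & forall v, v \in kids w -> v |: par v \subset D].
Proof.
move=> st wG; have [_ pD] := st_closed st; have wD := subsetP (st_sub st) w wG.
split=> // [|v vw]; first by apply: pD => //; apply: st_base st _ wG.
have vD := subsetP (st_children st wG) v vw.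
by rewrite subUset sub1set vD pD //; move: vw; rewrite inE => /andP[].
Qed.

Lemma extend_state D phi G c y x : state D phi G c -> y \in ready D ->
  x \in nbh H (phi @: par y) -> x \notin phi @: D ->
  state (y |: D) (upd phi y x) G c.
Proof.
move=> st; rewrite inE => /andP[yD py] xN xD.
have notD (A : {set W}) : A \subset D -> {in A, upd phi y x =1 phi}.
  by move=> /subsetP AD v /AD vD; rewrite /upd; case: eqP => // vy; rewrite -vy vD in yD.
split.
- by apply: down_closedU1 => //; apply: st_closed st.
- by apply: embeds_upd => //; [apply: st_closed st|apply: st_embeds st].
- by apply: subset_trans (st_sub st) (subsetUr _ _).
- exact: st_base st.
- by move=> w wG; apply: subset_trans (st_children st wG) (subsetUr _ _).
- exact: st_sep st.
move=> u f; rewrite upd_imsetU1 // in_setU1 negb_or => /andP[_ uD] cf.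
apply: leq_trans (st_count st uD cf) _; apply: subset_leq_card.
apply/subsetP => w; rewrite !inE => /andP[wG sw]; rewrite wG /=.
have [wD pwD kwD] := gadget_link st wG.
rewrite (swappable_ext (phi := phi)) //; first by apply: (notD [set w]); rewrite ?sub1set ?inE.
  exact: notD.
by move=> v vw; apply: notD; apply: subset_trans (kwD v vw); apply: subsetDl.
Qed.

Definition swap (phi : W -> V) (w y : W) (u : V) : W -> V :=
  upd (upd phi w u) y (phi w).

(** Swappability keeps the edges through [w] and creates the edge of [y]. The vertex [w] is not in
    the link of another gadget [w'], since a common edge would give a common vertex of their blocks;
    so only [w] itself is lost from the counts. *)
Lemma swap_state D phi G c y u w : state D phi G c.+1 -> y \in ready D ->
  u \notin phi @: D -> w \in G -> swappable u (phi @: par y) phi w ->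
  state (y |: D) (swap phi w y u) (G :\ w) c.
Proof.
move=> st yR uD wG /and3P[wN up uk]; have cl := st_closed st.
have ye0 := ready_notin_base cl yR.
move: yR; rewrite inE => /andP[yD py]; have [inj base edge] := st_embeds st.
have [wD pwD kwD] := gadget_link st wG.
have we0 := st_base st wG.
have wy : w \notin par y := ready_par_gadget st wG yD.
pose phi1 := upd phi w u.
have emb1 : embeds H e0 par D phi1.
  split.
  - move=> a b aD bD; rewrite /phi1 /upd; case: eqP => [->|_]; case: eqP => [->|_] //.
    + by move=> eq; move: uD; rewrite eq imset_f.
    + by move=> eq; move: uD; rewrite -eq imset_f.
    + exact: inj.
  - by rewrite upd_imset.
  - move=> v vD ve0; have [->|vw] := eqVneq v w.
      by rewrite /phi1 updE upd_imset // (notin_par to).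
    case: (boolP (w \in par v)) => wv; last first.
      by rewrite upd_imset // /phi1 /upd (negPf vw) edge.
    have vk : v \in kids w by rewrite inE ve0.
    rewrite -imsetU1 -(setD1K (_ : w \in v |: par v)) ?in_setU1 ?wv ?orbT //.
    by rewrite upd_imsetU1 ?setD11 // (forall_inP uk).
have eqD (A : {set W}) : A \subset D -> w \notin A -> {in A, swap phi w y u =1 phi}.
  move=> /subsetP AD wA v vA; rewrite /swap /upd.
  case: eqP => [vy|_]; first by rewrite -vy (AD v vA) in yD.
  by case: eqP => // vw; rewrite -vw vA in wA.
have imgsub : phi @: D \subset swap phi w y u @: (y |: D).
  apply/subsetP => _ /imsetP[v vD ->]; have [->|vw] := eqVneq v w.
    by apply/imsetP; exists y; rewrite ?setU11 // /swap updE.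
  apply/imsetP; exists v; first by rewrite in_setU1 vD orbT.
  by rewrite (eqD [set v]) ?sub1set ?in_set1 // eq_sym.
split.
- exact: down_closedU1.
- apply: embeds_upd => //; first by rewrite upd_imset.
  apply/negP => /imsetP[v vD]; rewrite /upd; case: eqP => [_ eq|vw eq].
    by move: uD; rewrite -eq imset_f.
  by case: vw; apply: inj.
- by apply: subset_trans (subsetDl _ _) (subset_trans (st_sub st) (subsetUr _ _)).
- by move=> v /setD1P[_ vG]; apply: (st_base st).
- move=> v /setD1P[_ vG].
  by apply: subset_trans (st_children st vG) (subsetUr _ _).
- by move=> a b /setD1P[_ aG] /setD1P[_ bG]; apply: (st_sep st).
move=> u' f u'D cf.
have {}u'D : u' \notin phi @: D by apply: contra u'D; apply: (subsetP imgsub).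
have cnt := st_count st u'D cf.
rewrite -ltnS; apply: leq_trans cnt _; rewrite (cardsD1 w).
have le1 : (forall b : bool, b + #|[set w' in G | swappable u' f phi w'] :\ w| <=
   #|[set w' in G | swappable u' f phi w'] :\ w|.+1)%N by case.
apply: leq_trans (le1 _) _; rewrite ltnS; apply: subset_leq_card.
apply/subsetP => w'; rewrite !inE => /and3P[w'w w'G sw]; rewrite w'w w'G /=.
have [w'D pw'D kw'D] := gadget_link st w'G.
have /pred0P dis := st_sep st w'G wG w'w.
have wb : w \in blk w by rewrite !in_setU !in_set1 eqxx orbT.
have w'b : w' \in blk w' by rewrite !in_setU !in_set1 eqxx orbT.
have kb a v : v \in kids a -> v \in blk a by move=> va; rewrite !in_setU va !orbT.
rewrite (swappable_ext (phi := phi)) //.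
- by apply: (eqD [set w']); rewrite ?sub1set ?in_set1 // eq_sym.
- apply: eqD => //; apply/negP => ww'; have := dis w'; rewrite /= w'b kb //.
  by rewrite inE ww' (st_base st w'G).
- move=> v vw'; apply: eqD; first by apply: subset_trans (kw'D v vw'); apply: subsetDl.
  rewrite in_setD1 negb_and in_setU1; apply/orP; right; rewrite negb_or.
  apply/andP; split.
    by apply/eqP => wv; have := dis w; rewrite /= wb wv kb.
  apply/negP => wv; have := dis v; rewrite /= !kb //.
  by move: vw'; rewrite !inE wv => /andP[->].
Qed.

Lemma finish m D phi G c : #|W| = #|V| -> #|unused D phi| = m -> (m <= c)%N ->
  state D phi G c -> exists phi', embeds H e0 par [set: W] phi'.
Proof.
move=> cWV; elim: m D phi G c => [|m IH] D phi G c cm mc st.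
  have := card_unused st; rewrite cm add0n -cWV => cD.
  have -> : [set: W] = D by apply/eqP; rewrite eq_sym eqEcard subsetT cardsT cD leqnn.
  by exists phi; apply: st_embeds st.
have DT : D != [set: W].
  apply/eqP => DT; have := card_unused st; rewrite cm DT cardsT cWV; clear; lia.
have [y yR] := ready_neq0 (st_closed st) DT.
have /card_gt0P[u] : (0 < #|unused D phi|)%N by rewrite cm.
rewrite inE => uD; case: c mc st => // c mc st.
have py : par y \subset D by move: yR; rewrite inE => /andP[].
have cpar : #|phi @: par y| = k.-1.
  rewrite card_in_imset ?(card_parE to) ?(ready_notin_base (st_closed st) yR) //.
  by case: (st_embeds st) => inj _ _ a b /(subsetP py) + /(subsetP py); apply: inj.
have /card_gt0P[w] := leq_trans (ltn0Sn c) (st_count st uD cpar).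
rewrite inE => /andP[wG sw].
have st' := swap_state st yR uD wG sw; apply: (IH _ _ _ _ _ mc st').
have := card_unused st; have := card_unused st'; rewrite cm cardsU1.
have -> : y \notin D by move: yR; rewrite inE => /andP[].
by clear; lia.
Qed.

(** * Almost spanning embedding with boundedly many swaps *)

Section Rich.

Variables (R : realType) (Delta t K : nat) (rho : R).
Hypothesis degE : forall w, (#|[set e in E | w \in e]| <= Delta)%N.
Hypothesis cWV : #|W| = #|V|.
Hypothesis rho_gt0 : 0 < rho.
Hypothesis rho_le1 : rho <= 1.
Hypothesis few : forall (U : {set V}) (G : {set {set V}}), (t <= #|U|)%N ->
  (forall g, g \in G -> #|g| = k.-1) ->
  (forall g, g \in G -> #|nbh H g :&: U|%:R <= rho / 2 * #|U|%:R) -> (#|G| <= K)%N.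
Hypothesis t_big : (Delta * K)%:R < rho / 4 * t%:R :> R.

Let rho2_ge0 : 0 <= 1 - rho / 2. Proof. have := rho_le1; lra. Qed.
Let rho4_ge0 : 0 <= 1 - rho / 4. Proof. have := rho_le1; lra. Qed.
Let rho_ge0 : 0 <= rho / 4. Proof. have := rho_gt0; lra. Qed.

Definition rich (U g : {set V}) : bool := rho / 2 * #|U|%:R <= #|nbh H g :&: U|%:R.

(** The images of [y] that would open a poor site. Requiring [x] outside the other parents' image
    makes the resulting set have size [k.-1], as [few] demands. *)
Definition spoilers (U : {set V}) (D : {set W}) (phi : W -> V) (y : W) : {set V} :=
  \bigcup_(v in [set v in kids y | par v :\ y \subset D])
     [set x | (x \notin phi @: (par v :\ y)) && ~~ rich U (x |: phi @: (par v :\ y))].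

Lemma card_spoilers (U : {set V}) (D : {set W}) (phi : W -> V) y :
  (t <= #|U|)%N -> {in D &, injective phi} ->
  (#|spoilers U D phi y| <= Delta * K)%N.
Proof.
move=> tU inj; rewrite /spoilers; set S := [set v in kids y | _].
have cS : (#|S| <= Delta)%N.
  apply: leq_trans (card_children to degE y); apply: subset_leq_card.
  by apply/subsetP => v; rewrite inE => /andP[].
apply: (@leq_trans (#|S| * K)); last by rewrite leq_mul2r cS orbT.
apply: card_bigcup_le => v; rewrite inE => /andP[]; rewrite inE => /andP[ve0 yv] sub.
set h := phi @: _; have ch : #|h| = k.-2.
  rewrite card_in_imset => [|a b /(subsetP sub) + /(subsetP sub)]; last exact: inj.
  by have := cardsD1 y (par v); rewrite yv (card_parE to ve0); case: (k) => [|[]] //= k' [].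
set B := [set x | _].
rewrite -(card_in_imset (f := fun x => x |: h) (D := mem B)) => [|a b]; last first.
  rewrite !inE => /andP[ah _] /andP[bh _] eq.
  by have : a \in b |: h; [rewrite -eq setU11|rewrite in_setU1 (negPf ah) orbF => /eqP].
apply: (few tU) => _ /imsetP[x + ->]; rewrite inE => /andP[xh].
  by rewrite cardsU1 xh ch; case: (k) k_ge2 => [|[]].
by rewrite /rich -ltNge => /ltW.
Qed.

Definition advance (D : {set W}) (phi : W -> V) (y : W) (phi' : W -> V) : Prop :=
  [/\ forall v, v \in ready D -> phi' @: par v = phi @: par v,
      unused (y |: D) phi' \subset unused D phi &
      forall v, v \in ready (y |: D) -> v \notin ready D ->
        rich (unused D phi) (phi' @: par v)].

(** Only gadgets move, so old sites keep their parent images. A newly opened site is a child of [y],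
    and avoiding the spoilers makes it rich. *)
Lemma advanceP D phi G c y phi' G' c' : state D phi G c ->
  state (y |: D) phi' G' c' -> y \in ready D -> {in D :\: G, phi' =1 phi} ->
  phi' y \notin spoilers (unused D phi) D phi y -> phi @: D \subset phi' @: (y |: D) ->
  advance D phi y phi'.
Proof.
move=> st st' yR agree good img.
have yD : y \notin D by move: yR; rewrite inE => /andP[].
have agree_par v (A : {set W}) : v \notin D -> A \subset par v -> A \subset D ->
    {in A, phi' =1 phi}.
  move=> vD /subsetP Apar /subsetP AD z zA; apply: agree; rewrite inE AD // andbT.
  by apply: contraTN (Apar z zA) => zG; apply: ready_par_gadget st zG vD.
split.
- by move=> v; rewrite inE => /andP[vD pv]; apply: eq_in_imset; apply: (agree_par v).
- by rewrite setCS.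
move=> v; rewrite inE in_setU1 negb_or => /andP[/andP[vy vD] pv].
rewrite inE vD /= => npv.
have ve0 : v \notin e0 by apply: contra vD; apply: (subsetP (st_closed st).1).
have sub : par v :\ y \subset D by rewrite subDset.
have yv : y \in par v.
  apply: contraNT npv => yv; apply/subsetP => z zv; have := subsetP pv z zv.
  by rewrite in_setU1 => /orP[/eqP zy|//]; rewrite -zy zv in yv.
have img_eq : phi' @: (par v :\ y) = phi @: (par v :\ y).
  by apply: eq_in_imset; apply: (agree_par v) => //; apply: subsetDl.
rewrite -(setD1K yv) imsetU1 img_eq; apply: contraNT good => nr.
apply/bigcupP; exists v; first by rewrite !inE ve0 yv.
rewrite inE nr andbT -img_eq; apply/negP => /imsetP[z zv eq].
have [inj _ _] := st_embeds st'.
have yz : y = z.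
  by apply: inj => //; rewrite in_setU1 ?eqxx // (subsetP sub) ?orbT.
by rewrite yz setD11 in zv.
Qed.

Lemma card_unused_advance D phi G c y phi' G' c' : state D phi G c ->
  state (y |: D) phi' G' c' -> y \in ready D ->
  #|unused D phi| = #|unused (y |: D) phi'|.+1.
Proof.
move=> st st'; rewrite inE => /andP[yD _].
by have := card_unused st; have := card_unused st'; rewrite cardsU1 yD; clear; lia.
Qed.

(** The threshold is the bound on the number of spoilers, so some admissible image spoils
    nothing. *)
Definition usable D phi y : bool :=
  (Delta * K < #|nbh H (phi @: par y) :&: unused D phi|)%N.

Lemma step_usable D phi G c y : state D phi G c -> y \in ready D ->
  (t <= #|unused D phi|)%N -> usable D phi y ->
  exists2 phi', state (y |: D) phi' G c & advance D phi y phi'.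
Proof.
move=> st yR tU us; have [inj _ _] := st_embeds st.
have yD : y \notin D by move: yR; rewrite inE => /andP[].
have : ~~ (nbh H (phi @: par y) :&: unused D phi \subset spoilers (unused D phi) D phi y).
  apply/negP => /subset_leq_card; apply/negP; rewrite -ltnNge.
  exact: leq_ltn_trans (card_spoilers y tU inj) us.
case/subsetPn => x; rewrite in_setI [x \in unused _ _]inE => /andP[xN xD] xs.
have st' := extend_state st yR xN xD.
exists (upd phi y x) => //; apply: advanceP st st' yR _ _ _; rewrite ?updE //.
  move=> v /setDP[vD _]; rewrite /upd; case: eqP => // vy; by rewrite -vy vD in yD.
by rewrite upd_imsetU1 // subsetUr.
Qed.

(** The more than [Delta * K] swappable gadgets have distinct images, so one of these images is not
    a spoiler and can be handed to [y]. *)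
Lemma step_swap D phi G c y : state D phi G c.+1 -> y \in ready D ->
  (t <= #|unused D phi|)%N -> (Delta * K <= c)%N ->
  exists phi' G', state (y |: D) phi' G' c /\ advance D phi y phi'.
Proof.
move=> st yR tU big; have [inj _ _] := st_embeds st.
have /andP[yD py] : (y \notin D) && (par y \subset D) by move: yR; rewrite inE.
have t_gt0 : (0 < t)%N.
  case: (t) t_big => //; rewrite mulr0 ltNge ler0n //.
have /card_gt0P[u] : (0 < #|unused D phi|)%N by apply: leq_trans tU.
rewrite inE => uD.
have cpar : #|phi @: par y| = k.-1.
  rewrite card_in_imset ?(card_parE to) ?(ready_notin_base (st_closed st) yR) //.
  by move=> a b /(subsetP py) + /(subsetP py); apply: inj.
have cnt := st_count st uD cpar; set S := [set w in G | _] in cnt.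
have SD : S \subset D.
  by apply/subsetP => w; rewrite inE => /andP[wG _]; apply: (subsetP (st_sub st)).
have : ~~ (phi @: S \subset spoilers (unused D phi) D phi y).
  apply/negP => /subset_leq_card; apply/negP; rewrite -ltnNge.
  rewrite card_in_imset; last by move=> a b /(subsetP SD) + /(subsetP SD); apply: inj.
  apply: leq_ltn_trans (card_spoilers y tU inj) _; exact: leq_ltn_trans big cnt.
case/subsetPn => _ /imsetP[w + ->] good; rewrite inE => /andP[wG sw].
have st' := swap_state st yR uD wG sw.
exists (swap phi w y u), (G :\ w); split=> //.
have agree v : v \in D -> v != w -> swap phi w y u v = phi v.
  move=> vD /negPf vw; rewrite /swap /upd vw.
  by case: eqP => // vy; rewrite -vy vD in yD.
apply: (advanceP st st' yR).
- by move=> v /setDP[vD vG]; apply: agree => //; apply: contra vG => /eqP->.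
- by rewrite /swap updE.
apply/subsetP => _ /imsetP[v vD ->]; have [->|vw] := eqVneq v w.
  by apply/imsetP; exists y; rewrite ?setU11 // /swap updE.
by apply/imsetP; exists v; rewrite ?in_setU1 ?vD ?orbT // agree.
Qed.

Lemma ready_exists D phi G c : state D phi G c -> (t <= #|unused D phi|)%N ->
  exists y, y \in ready D.
Proof.
move=> st tU; apply: ready_neq0 (st_closed st) _; apply/eqP => DT.
have := card_unused st; rewrite DT cardsT cWV -DT.
have t_gt0 : (0 < t)%N by case: (t) t_big => //; rewrite mulr0 ltNge ler0n.
by move: tU t_gt0; clear; lia.
Qed.

(* Starting when nothing was usable, only the [Old] sites can require a swap: every
   site created since then misses at most [(1 - rho / 2) * r] of the unused vertices. *)
Lemma epoch r (Old : {set W}) m D phi G c b : #|unused D phi| = m ->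
  state D phi G (c + b) -> (#|Old :\: D| <= b)%N -> (m <= r)%N -> (Delta * K <= c)%N ->
  (forall v, v \in ready D -> v \notin Old ->
     #|unused D phi :\: nbh H (phi @: par v)|%:R <= (1 - rho / 2) * r%:R) ->
  exists D' phi' G', state D' phi' G' c /\
    ((#|unused D' phi'| < t)%N \/ #|unused D' phi'|%:R < (1 - rho / 4) * r%:R).
Proof.
elim: m D phi G b => [|m IH] D phi G b cm st oldb mr big fresh.
all: have stc : state D phi G c by apply: state_le st; apply: leq_addr.
  exists D, phi, G; split=> //; left; rewrite cm.
  by case: (t) t_big => //; rewrite mulr0 ltNge ler0n.
have [lt|tU] := ltnP #|unused D phi| t; first by exists D, phi, G; split; [|left].
have [rU|lt] := lerP ((1 - rho / 4) * r%:R) #|unused D phi|%:R; last first.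
  by exists D, phi, G; split; [|right].
have keep y phi' : y \in ready D -> advance D phi y phi' ->
    forall v, v \in ready (y |: D) -> v \notin Old ->
     #|unused (y |: D) phi' :\: nbh H (phi' @: par v)|%:R <= (1 - rho / 2) * r%:R.
  move=> yR [same sub new] v vR vOld.
  have {}sub (N : {set V}) : (#|unused (y |: D) phi' :\: N| <= #|unused D phi :\: N|)%N.
    by apply: subset_leq_card; apply: setSD.
  have [vR'|vR'] := boolP (v \in ready D).
    rewrite same //; apply: le_trans (fresh v vR' vOld).
    by rewrite ler_nat.
  have := new v vR vR'; rewrite /rich setIC => h.
  have := cardsID (nbh H (phi' @: par v)) (unused D phi).
  move/(congr1 (fun i => i%:R : R)); rewrite natrD => h2.
  apply: (@le_trans _ _ #|unused D phi :\: nbh H (phi' @: par v)|%:R); first by rewrite ler_nat.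
  apply: (@le_trans _ _ ((1 - rho / 2) * #|unused D phi|%:R)); first by lra.
  by apply: ler_wpM2l; [exact: rho2_ge0|rewrite ler_nat cm].
case: (boolP [exists y in ready D, usable D phi y]) => [/exists_inP[y yR us]|].
  have [phi' st' adv] := step_usable st yR tU us.
  have [|||D' [phi'' [G' res]]] := IH _ _ _ b _ st' _ _ big (keep y phi' yR adv).
  - by have := card_unused_advance st st' yR; rewrite cm => -[].
  - apply: leq_trans oldb; apply: subset_leq_card; apply: setDS; exact: subsetUr.
  - exact: ltnW.
  by exists D', phi'', G'.
rewrite negb_exists_in => /forall_inP stuck.
have [y yR] := ready_exists st tU.
have yOld : y \in Old.
  apply: contraNT (stuck y yR) => yOld; have h := fresh y yR yOld.
  have := cardsID (nbh H (phi @: par y)) (unused D phi).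
  move/(congr1 (fun i => i%:R : R)); rewrite natrD setIC => h2.
  have tr : t%:R <= r%:R :> R by rewrite ler_nat (leq_trans tU) // cm.
  have rtr : rho / 4 * t%:R <= rho / 4 * r%:R by rewrite ler_wpM2l.
  rewrite /usable -(ltr_nat R); have := t_big; lra.
have yD : y \notin D by move: yR; rewrite inE => /andP[].
(* The swap budget is not exhausted, since [y] is an old site still to be embedded. *)
case: b st oldb => [|b] st oldb.
  by move: oldb; rewrite leqn0 cards_eq0 => /eqP/setP/(_ y); rewrite !inE yD yOld.
rewrite addnS in st.
have [phi' [G' [st' adv]]] := step_swap st yR tU (leq_trans big (leq_addr _ _)).
have [|||D' [phi'' [G'' res]]] := IH _ _ _ b _ st' _ _ big (keep y phi' yR adv).
- by have := card_unused_advance st st' yR; rewrite cm => -[].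
- rewrite -ltnS; apply: leq_trans oldb; rewrite (cardsD1 y (Old :\: D)) inE yD yOld ltnS.
  by apply: subset_leq_card; apply/subsetP => z; rewrite !inE negb_or -andbA.
- exact: ltnW.
by exists D', phi'', G''.
Qed.

(** Unusable sites have poor parent images, hence at most [K] of them; sites sharing an image are
    children of a common vertex, hence at most [Delta] per image. *)
Lemma card_stuck D phi G c : state D phi G c -> (t <= #|unused D phi|)%N ->
  (forall y, y \in ready D -> ~~ usable D phi y) -> (#|ready D| <= Delta * K)%N.
Proof.
move=> st tU stuck; have [inj _ _] := st_embeds st; have cl := st_closed st.
pose S := [set phi @: par y | y in ready D].
have cpar y : y \in ready D -> #|phi @: par y| = k.-1.
  move=> yR; have py : par y \subset D by move: yR; rewrite inE => /andP[].
  rewrite card_in_imset ?(card_parE to) ?(ready_notin_base cl yR) //.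
  by move=> a b /(subsetP py) + /(subsetP py); apply: inj.
have cS : (#|S| <= K)%N.
  apply: (few tU) => _ /imsetP[y yR ->]; first exact: cpar.
  have tf : t%:R <= #|unused D phi|%:R :> R by rewrite ler_nat.
  have := stuck y yR; rewrite /usable -leqNgt -(ler_nat R) => le.
  have : rho / 4 * t%:R <= rho / 2 * #|unused D phi|%:R.
    by apply: ler_pM => //; have := rho_gt0; lra.
  by have := t_big; lra.
pose fib g := [set y in ready D | phi @: par y == g].
have sub : ready D \subset \bigcup_(g in S) fib g.
  apply/subsetP => y yR; apply/bigcupP; exists (phi @: par y); first exact: imset_f.
  by rewrite inE yR eqxx.
apply: leq_trans (subset_leq_card sub) _.
apply: (@leq_trans (#|S| * Delta)); last by rewrite mulnC leq_mul2l cS orbT.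
apply: card_bigcup_le => _ /imsetP[y yR ->].
have /card_gt0P[w wy] : (0 < #|par y|)%N.
  by rewrite (card_parE to (ready_notin_base cl yR)); case: (k) k_ge2 => [|[]].
apply: leq_trans (card_children to degE w); apply: subset_leq_card.
apply/subsetP => v; rewrite inE => /andP[vR /eqP eq].
rewrite inE (ready_notin_base cl vR) /=.
have pD u : u \in ready D -> par u \subset D by rewrite inE => /andP[].
have /imsetP[w' w'v ww'] : phi w \in phi @: par v by rewrite eq imset_f.
suff -> : w = w' by [].
by apply: inj => //; [apply: (subsetP (pD y yR))|apply: (subsetP (pD v vR))].
Qed.

Lemma almost_spanning e m D phi G c : #|unused D phi| = m ->
  state D phi G (c + e * (Delta * K)) -> (1 - rho / 4) ^+ e * m%:R < t%:R ->
  (Delta * K <= c)%N ->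
  exists D' phi' G', state D' phi' G' c /\ (#|unused D' phi'| < t)%N.
Proof.
elim: e m D phi G => [|e IHe].
  move=> m D phi G cm st; rewrite expr0 mul1r ltr_nat => mt _.
  by exists D, phi, G; rewrite cm; split=> //; apply: state_le st; apply: leq_addr.
elim=> [|m IHm] D phi G cm st mt big.
all: have stc : state D phi G c by apply: state_le st; apply: leq_addr.
  by exists D, phi, G; split=> //; rewrite cm; move: mt; rewrite mulr0 ltr0n.
have [lt|tU] := ltnP #|unused D phi| t; first by exists D, phi, G.
case: (boolP [exists y in ready D, usable D phi y]) => [/exists_inP[y yR us]|].
  have [phi' st' adv] := step_usable st yR tU us.
  apply: (IHm _ _ _ _ st' _ big).
    by have := card_unused_advance st st' yR; rewrite cm => -[].
  apply: le_lt_trans mt; by rewrite ler_wpM2l ?ler_nat // exprn_ge0.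
rewrite negb_exists_in => /forall_inP stuck.
have cR := card_stuck st tU stuck.
rewrite mulSn addnCA addnC in st.
have old : (#|ready D :\: D| <= Delta * K)%N.
  by apply: leq_trans cR; apply: subset_leq_card; apply: subsetDl.
have [|||D1 [phi1 [G1 [st1 small]]]] := @epoch m.+1 (ready D) m.+1 _ _ _ _ _ cm st old.
- by [].
- by apply: leq_trans big (leq_addr _ _).
- by move=> v vR; rewrite vR.
case: small => [lt|lt].
  by exists D1, phi1, G1; split=> //; apply: state_le st1; apply: leq_addr.
apply: (IHe _ _ _ _ erefl st1 _ big).
apply: le_lt_trans mt; by rewrite exprSr -mulrA ler_wpM2l ?exprn_ge0 // ltW.
Qed.

End Rich.
End Completion.

(** * Choice of the constants *)

(** Bernoulli's inequality, in the form [a ^+ N * (1 + N%:R * (1 - a)) <= 1]. *)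
Lemma exists_exp_lt (R : realType) (a x : R) : 0 <= a < 1 -> 0 < x ->
  exists N, a ^+ N < x.
Proof.
move=> /andP[a_ge0 a_lt1] x_gt0; have d_gt0 : 0 < 1 - a by rewrite subr_gt0.
have bern N : a ^+ N * (1 + N%:R * (1 - a)) <= 1.
  elim: N => [|N IH]; first by rewrite expr0 mul0r addr0 mulr1.
  apply: le_trans IH; rewrite exprSr -mulrA ler_wpM2l ?exprn_ge0 //.
  have : 0 <= N.+1%:R * (1 - a) ^+ 2 by rewrite mulr_ge0 ?ler0n ?sqr_ge0.
  by rewrite -natr1; lra.
have y_ge0 : 0 <= (x * (1 - a))^-1 by rewrite invr_ge0 mulr_ge0 // ltW.
have := archi_boundP y_ge0; set N := Num.bound _ => big; exists N.
rewrite ltNge; apply/negP => le; have := bern N; apply/negP; rewrite -ltNge.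
have xd : 0 < x * (1 - a) by rewrite mulr_gt0.
have {}big : 1 < x * (N%:R * (1 - a)).
  by rewrite -(ltr_pM2l xd) mulfV ?gt_eqF // in big; lra.
apply: lt_le_trans big _; apply: ler_pM => //; first exact: ltW.
  by rewrite mulr_ge0 ?ler0n // ltW.
by rewrite lerDr.
Qed.

(** With [s] about [t / d], the left side is at most [M * 2 ^ (k * s)]; the choice of [d] makes
    [k * s] at most half of [t], and [M] is at most the other half. *)
Lemma exists_exp_gt (k q : nat) : exists t0, forall t, (t0 <= t)%N ->
  ((q * t.+1) ^ k < 2 ^ t)%N.
Proof.
pose d := (2 * k.+1)%N; pose M := ((q * d) ^ k)%N; exists (2 * M)%N => t Mt.
pose s := (t %/ d)%N.
have td : (t.+1 <= d * 2 ^ s)%N.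
  apply: (@leq_trans (d * s.+1)).
    by rewrite mulnC ltn_ceil.
  by rewrite leq_mul2l ltn_expl // orbT.
have st : (k * s + M <= t)%N.
  have : (s * d <= t)%N by apply: leq_trunc_div.
  move: Mt; rewrite /d; clear; nia.
apply: (@leq_ltn_trans (M * 2 ^ (k * s))).
  rewrite [(M * _)%N]mulnC [(k * s)%N]mulnC expnM -expnMn.
  have le : (q * t.+1 <= 2 ^ s * (q * d))%N by rewrite mulnCA [(2 ^ s * d)%N]mulnC leq_mul.
  by case: (k) => // k'; rewrite leq_exp2r.
apply: (@leq_trans (2 ^ M * 2 ^ (k * s))).
  by rewrite ltn_mul2r expn_gt0 ltn_expl.
by rewrite -expnD addnC leq_exp2l.
Qed.

Lemma bin_le_exp n m : ('C(n, m) <= n ^ m)%N.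
Proof.
apply: (@leq_trans (n ^_ m)).
  by rewrite -bin_ffact leq_pmulr // fact_gt0.
elim: m => [|m IH]; first by rewrite ffactn0.
by rewrite ffactnSr expnSr leq_mul // leq_subr.
Qed.

Lemma card_keys k (V : finType) : (0 < k)%N -> (#|keys k V| <= #|V| ^ k)%N.
Proof.
move=> k_gt0; have sub : keys k V \subset setX [set: V] [set f : {set V} | #|f| == k.-1].
  by apply/subsetP => -[u f]; rewrite !inE.
apply: leq_trans (subset_leq_card sub) _; rewrite cardsX cardsT card_draws.
by rewrite -{2}(prednK k_gt0) expnS leq_mul2l bin_le_exp orbT.
Qed.

Lemma exists_card_set (V : finType) m : (m <= #|V|)%N -> exists A : {set V}, #|A| = m.
Proof.
move=> mV; exists [set x in take m (enum V)].
rewrite cardsE (card_uniqP _) ?take_uniq ?enum_uniq // size_take -cardE.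
by case: ltnP => // le; apply/eqP; rewrite eqn_leq le mV.
Qed.

Lemma bij_onto (W V : finType) (A : {set W}) (B : {set V}) : #|A| = #|B| -> (0 < #|B|)%N ->
  exists2 f : W -> V, {in A &, injective f} & f @: A = B.
Proof.
move=> cAB /card_gt0P[v0 _]; pose f w := nth v0 (enum B) (index w (enum A)).
have idx w : w \in A -> (index w (enum A) < size (enum B))%N.
  by move=> wA; rewrite -cardE -cAB cardE index_mem mem_enum.
have finj : {in A &, injective f}.
  move=> a b aA bA /eqP; rewrite nth_uniq ?enum_uniq ?idx // => /eqP eq.
  by rewrite -(nth_index a (_ : a \in enum A)) ?mem_enum // eq nth_index // mem_enum.
exists f => //; apply/eqP; rewrite eqEcard card_in_imset // cAB leqnn andbT.
by apply/subsetP => _ /imsetP[w wA ->]; rewrite -mem_enum mem_nth // idx.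
Qed.

Lemma card_edges_at k (W : finType) (T : kgraph k W) w :
  (#|[set e in edges T | w \in e]| <= max_degree1 T)%N.
Proof. exact: (leq_bigmax w). Qed.

Lemma spanning_ktree_density_le1 (R : realType) (k Delta : nat) (rho : R) :
  (2 <= k)%N -> 0 < rho -> rho <= 1 ->
  exists (n0 : nat) (eps0 : R), 0 < eps0 /\
    forall eps : R, 0 < eps -> eps <= eps0 ->
    forall (n : nat) (V : finType) (H : kgraph k V),
      #|V| = n -> (n0 <= n)%N -> typical H rho 2 eps ->
      forall (W : finType) (T : kgraph k W),
        #|W| = n -> is_ktree T -> (max_degree1 T <= Delta)%N ->
        contains H T.
Proof.
move=> k_ge2 rho_gt0 rho_le1.
have rho2_gt0 : 0 < rho ^+ 2 by rewrite exprn_gt0.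
have rho2_le1 : rho ^+ 2 <= 1 by rewrite exprn_ile1 // ltW.
(* Of the pair density [rho ^+ 2], half is kept as [p]; a quarter covers [eps] and a quarter the set
   [D]. *)
pose p := rho ^+ 2 / 2.
have p_gt0 : 0 < p by rewrite /p; lra.
have p_le1 : p <= 1 by rewrite /p; lra.
(* Starting from [n %/ Q] low vertices keeps [D], which also contains their children, below
   [rho ^+ 2 / 4 * n]. *)
pose Q := (Num.bound (8 * Delta.+1%:R / rho ^+ 2)).+1.
have Q_big : 8 * Delta.+1%:R <= Q%:R * rho ^+ 2.
  have : 0 <= 8 * Delta.+1%:R / rho ^+ 2 by rewrite divr_ge0 ?mulr_ge0 ?ler0n ?ltW.
  move/archi_boundP => /ltW h; rewrite -ler_pdivrMr //; apply: le_trans h _.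
  by rewrite ler_nat.
pose a := 1 - p ^+ Delta.+2 / 2.
have pD_gt0 : 0 < p ^+ Delta.+2 by rewrite exprn_gt0.
have pD_le1 : p ^+ Delta.+2 <= 1 by rewrite exprn_ile1 // ltW.
have a_bnd : 0 <= a < 1 by apply/andP; rewrite /a; split; lra.
(* A group of [N] blocks gains a factor 1/4: one factor 1/2 will beat the number of keys, the other
   remains for the count. *)
have [N0 aN0] : exists N, a ^+ N < 1 / 4 by apply: exists_exp_lt => //; lra.
pose N := N0.+1.
have aN : a ^+ N <= 1 / 4.
  case/andP: a_bnd => a_ge0 a_lt1.
  by apply: le_trans (ltW aN0); rewrite ler_wiXn2l // ltW.
pose M1 := (Delta.+2 * (Delta + k).+1)%N.
pose q := (4 * Q * M1 * N)%N.
have q_gt0 : (0 < q)%N by rewrite /q /M1 !muln_gt0.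
have qR_gt0 : 0 < q%:R :> R by rewrite ltr0n.
(* For [#|U|] at least [n / (2 * q)], [few_poor] gives [16 * q / rho ^+ 2] as a bound once the term
   in [eps] is absorbed. *)
pose K := Num.bound (16 * q%:R / rho ^+ 2).
have K_big : 16 * q%:R <= K%:R * rho ^+ 2.
  have : 0 <= 16 * q%:R / rho ^+ 2 by rewrite divr_ge0 ?mulr_ge0 ?ler0n ?ltW.
  by move/archi_boundP => /ltW h; rewrite -ler_pdivrMr.
have [e small_e] : exists e, (1 - rho / 4) ^+ e < (2 * q%:R)^-1.
  apply: exists_exp_lt; first by apply/andP; split; lra.
  by rewrite invr_gt0; lra.
pose T1 := Num.bound ((Delta * K)%:R * 4 / rho).
have T1_big t : (T1 <= t)%N -> (Delta * K)%:R < rho / 4 * t%:R.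
  move=> T1t; have : 0 <= (Delta * K)%:R * 4 / rho by rewrite divr_ge0 ?mulr_ge0 ?ler0n ?ltW.
  move/archi_boundP; rewrite -/T1 => h.
  have {}h : (Delta * K)%:R * 4 / rho < t%:R by apply: lt_le_trans h _; rewrite ler_nat.
  by move: h; rewrite ltr_pdivrMr //; lra.
have [T2 T2_big] := exists_exp_gt k q.
pose T0 := (k * Delta.+1 + e * (Delta * K) + T1 + T2)%N.
have T0_gt0 : (0 < k * Delta.+1)%N by rewrite muln_gt0 (ltnW k_ge2).
exists (q * T0)%N, (rho ^+ 2 / (48 * q%:R)); split.
  by rewrite divr_gt0 //; lra.
move=> eps eps_gt0 eps_le n V H cV n_big typH W T cW treeT degT.
have epsq : eps * (48 * q%:R) <= rho ^+ 2 by rewrite -ler_pdivlMr //; lra.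
have eps4 : 4 * eps <= rho ^+ 2.
  have : 1 <= q%:R :> R by rewrite ler1n.
  move=> q1; have : eps * 1 <= eps * q%:R by rewrite ler_wpM2l // ltW.
  lra.
pose t := (n %/ q)%N.
have T0t : (T0 <= t)%N by rewrite /t leq_divRL // mulnC.
have t_gt0 : (0 < t)%N by move: T0t T0_gt0; rewrite /T0; clear; lia.
have nt : (n < q * t.+1)%N by rewrite mulnC ltn_ceil.
have n2t : (n <= 2 * q * t)%N by move: nt t_gt0; clear; nia.
have tn : (q * t <= n)%N by rewrite mulnC leq_trunc_div.
have [e0 [rk [par to]]] := ktree_order (ltnW k_ge2) treeT.
have degE w : (#|[set e in edges T | w \in e]| <= Delta)%N.
  exact: leq_trans (card_edges_at T w) degT.
have cWV : #|W| = #|V| by rewrite cV cW.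
pose m := (n %/ Q)%N.
have mQ : (m * Q <= n)%N by apply: leq_trunc_div.
have kD_le_t : (k * Delta.+1 <= t)%N by move: T0t; rewrite /T0; clear; lia.
have m_big : (4 * M1 * N * t <= m)%N.
  rewrite /m leq_divRL //; apply: leq_trans tn.
  by have -> : (4 * M1 * N * t * Q = q * t)%N by rewrite /q; ring.
have mW : (0 < m <= #|W|)%N.
  apply/andP; split; last by rewrite cW leq_div.
  by apply: leq_trans m_big; rewrite !muln_gt0.
have [D [J [Dcl cD cJ Jblock Jdisj]]] := disjoint_blocks k_ge2 to degE mW.
have n_gt0 : (0 < n)%N by apply: leq_trans tn; rewrite muln_gt0 q_gt0.
have nR : 0 < n%:R :> R by rewrite ltr0n.
have cD4 : #|D|%:R <= rho ^+ 2 / 4 * n%:R.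
  have mk : ((m + k) * Q <= 2 * n)%N.
    have : (k * Q <= n)%N.
      apply: leq_trans tn; rewrite mulnC leq_mul //.
        by rewrite /q /M1 -!mulnA mulnCA leq_pmulr.
      by apply: leq_trans kD_le_t; rewrite leq_pmulr.
    by move: mQ; clear; nia.
  have h1 : #|D|%:R <= (m + k)%:R * Delta.+1%:R :> R by rewrite -natrM ler_nat.
  have h2 : (m + k)%:R * Q%:R <= 2 * n%:R :> R by rewrite -!natrM ler_nat.
  have h3 : (m + k)%:R * (8 * Delta.+1%:R) <= (m + k)%:R * (Q%:R * rho ^+ 2) :> R.
    by rewrite ler_wpM2l ?ler0n.
  have h4 : (m + k)%:R * Q%:R * rho ^+ 2 <= 2 * n%:R * rho ^+ 2.
    by rewrite ler_wpM2r // ltW.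
  lra.
have nbh2_big (g g' : {set V}) : #|g| = k.-1 -> #|g'| = k.-1 ->
    p * #|V|%:R + #|D|%:R <= #|nbh H g :&: nbh H g'|%:R.
  move=> cg cg'; apply: le_trans (nbh2_ge typH rho_gt0 rho_le1 cg cg').
  rewrite cV; apply: (@le_trans _ _ (p * n%:R + rho ^+ 2 / 4 * n%:R)); first by lra.
  by rewrite -mulrDl ler_wpM2r ?ler0n // /p; lra.
have V_gt0 : (0 < #|V|)%N by rewrite cV.
have [phi0 emb0] : exists phi0, embeds H e0 par e0 phi0.
  have kn : (k.-1 <= #|V|)%N.
    rewrite cV; apply: leq_trans tn; rewrite -[k.-1]mul1n leq_mul //.
    by apply: leq_trans (leq_pred _) (leq_trans _ kD_le_t); rewrite leq_pmulr.
  have [g cg] := exists_card_set kn.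
  have := nbh2_big g g cg cg; rewrite setIid => h.
  have /card_gt0P[v] : (0 < #|nbh H g|)%N.
    rewrite -(ltr_nat R); apply: lt_le_trans h.
    by rewrite ltr_pwDl ?ler0n // mulr_gt0 // ltr0n.
  rewrite in_nbh => vH; have cv := edges_uniform vH.
  have [|//|phi0 inj img] := @bij_onto _ _ e0 (v |: g).
  - by rewrite cv (card_base to).
  - by rewrite cv ltnW.
  by exists phi0; split=> //; [rewrite img|move=> y ->].
pose c := (#|J| %/ N)%N.
(* One [t] is reserved for the final swaps, the other covers the [e * (Delta * K)] swaps of the
   epochs. *)
have tc : (2 * t <= c)%N.
  rewrite /c leq_divRL //.
  have gen (j M l d s r : nat) : (4 * M * l * r <= s)%N -> (s <= j * M + d)%N ->
      (d <= r)%N -> (0 < M)%N -> (0 < l)%N -> (2 * r * l <= j)%N.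
    clear => h1 h2 h3 h4 h5; rewrite -(leq_pmul2r h4).
    have h6 : (r <= M * l * r)%N by rewrite leq_pmull // muln_gt0 h4.
    nia.
  by apply: (gen _ M1 N _ _ t m_big cJ kD_le_t) => //; rewrite /M1 muln_gt0.
(* There are at most [n ^ k < 2 ^ t] keys, while [a ^+ #|J|] is at most [(1 / 4) ^+ c]. *)
have small : #|keys k V|%:R * a ^+ #|J| < (1 / 2) ^+ c.
  have nk : (#|keys k V| < 2 ^ c)%N.
    apply: leq_ltn_trans (card_keys V (ltnW k_ge2)) _; rewrite cV.
    apply: (@leq_ltn_trans ((q * t.+1) ^ k)); first by rewrite leq_exp2r ltnW.
    apply: (@leq_trans (2 ^ t)); first by apply: T2_big; move: T0t; rewrite /T0; clear; lia.
    by rewrite leq_exp2l //; move: tc; clear; lia.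
  case/andP: a_bnd => a_ge0 a_lt1.
  have aJ : a ^+ #|J| <= (1 / 4) ^+ c.
    apply: (@le_trans _ _ ((a ^+ N) ^+ c)).
      by rewrite -exprM ler_wiXn2l ?(ltW a_lt1) // mulnC leq_trunc_div.
    by apply: lerXn2r => //; rewrite ?nnegrE ?exprn_ge0 //; lra.
  have h4 : (1 / 4 : R) ^+ c = (1 / 2) ^+ c * (1 / 2) ^+ c.
    by rewrite -exprMn; congr (_ ^+ _); field.
  have h2 : (2 ^ c)%:R * (1 / 2) ^+ c = 1 :> R.
    by rewrite natrX -exprMn mulrC mul1r mulVf ?expr1n // pnatr_eq0.
  have half_gt0 : 0 < (1 / 2 : R) ^+ c by rewrite exprn_gt0 //; lra.
  apply: (@le_lt_trans _ _ (#|keys k V|%:R * (1 / 4) ^+ c)).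
    by rewrite ler_wpM2l ?ler0n.
  rewrite h4 mulrA gtr_pMl // -[ltRHS]h2 ltr_pM2r // ltr_nat //.
have [phi st] := greedy_state k_ge2 to degE p_gt0 p_le1 V_gt0 Dcl Jblock Jdisj
  nbh2_big emb0 small.
have few (U : {set V}) (G : {set {set V}}) : (t <= #|U|)%N ->
    (forall g, g \in G -> #|g| = k.-1) ->
    (forall g, g \in G -> #|nbh H g :&: U|%:R <= rho / 2 * #|U|%:R) -> (#|G| <= K)%N.
  move=> tU cG poor; have := few_poor typH rho_gt0 rho_le1 eps_gt0 cG poor.
  rewrite natrM cV => h.
  have nU : n%:R <= 2 * q%:R * #|U|%:R :> R.
    rewrite -!natrM ler_nat; apply: leq_trans n2t _; exact: leq_mul.
  have U_gt0 : 0 < #|U|%:R :> R by rewrite ltr0n (leq_trans t_gt0).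
  set x := #|G|%:R in h; have x_ge0 : 0 <= x by rewrite /x ler0n.
  have f_ge0 : 0 <= 4 * (3 * eps * x + 1).
    by rewrite mulr_ge0 // addr_ge0 // !mulr_ge0 // ltW.
  have h' : rho ^+ 2 * x <= 4 * (3 * eps * x + 1) * (2 * q%:R).
    rewrite -(ler_pM2r U_gt0); have := ler_wpM2l f_ge0 nU; lra.
  have h2 : x * (eps * (48 * q%:R)) <= x * rho ^+ 2 by rewrite ler_wpM2l.
  rewrite -(ler_nat R) -/x -(ler_pM2r rho2_gt0); lra.
have t_big : (Delta * K)%:R < rho / 4 * t%:R.
  by apply: T1_big; move: T0t; rewrite /T0; clear; lia.
have DK_t : (Delta * K <= t)%N.
  rewrite -(ler_nat R); have : rho / 4 * t%:R <= 1 * t%:R by rewrite ler_wpM2r ?ler0n //; lra.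
  lra.
have st' : state H e0 rk par D phi J (t + e * (Delta * K)).
  apply: state_le st; apply: leq_trans tc.
  by move: T0t; rewrite /T0; clear; lia.
have ready : (1 - rho / 4) ^+ e * #|unused D phi|%:R < t%:R.
  have le : #|unused D phi|%:R <= 2 * q%:R * t%:R :> R.
    by rewrite -!natrM ler_nat (leq_trans _ n2t) // -cV max_card.
  apply: (@le_lt_trans _ _ ((1 - rho / 4) ^+ e * (2 * q%:R * t%:R))).
    by rewrite ler_wpM2l // exprn_ge0 //; lra.
  rewrite mulrA -[ltRHS]mul1r ltr_pM2r ?ltr0n // -ltr_pdivlMr ?div1r //; lra.
have [D' [phi' [G' [st2 lt]]]] :=
  almost_spanning k_ge2 to degE cWV rho_gt0 rho_le1 few t_big erefl st' ready DK_t.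
have [psi [inj base edge]] := finish to cWV erefl (ltnW lt) st2.
exists psi; first by move=> x y; apply: inj.
move=> f; rewrite (tree_edges to) => /setU1P[->//|/imsetP[y]].
by rewrite !inE andbT => ye0 ->; rewrite imsetU1 edge ?inE.
Qed.

Theorem theorem1p4 (R : realType) (k Delta : nat) (rho : R) :
  (2 <= k)%N -> (2 <= Delta)%N -> 0 < rho ->
  exists (n0 : nat) (eps0 : R), 0 < eps0 /\
    forall eps : R, 0 < eps -> eps <= eps0 ->
    forall (n : nat) (V : finType) (H : kgraph k V),
      #|V| = n -> (n0 <= n)%N -> typical H rho 2 eps ->
      forall (W : finType) (T : kgraph k W),
        #|W| = n -> is_ktree T -> (max_degree1 T <= Delta)%N ->
        contains H T.
Proof.
move=> k_ge2 _ rho_gt0; have [rho_le1|rho_gt1] := lerP rho 1.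
  exact: spanning_ktree_density_le1.
(* For [rho > 1] no such [H] is typical: a set of size [k.-1], which exists as [n >= k], would have
   degree above [n]. *)
exists k, ((rho - 1) / 2); split; first lra.
move=> eps eps_gt0 eps_le n V H cV kn typH.
have [g cg] : exists g : {set V}, #|g| = k.-1.
  by apply: exists_card_set; rewrite cV (leq_trans (leq_pred k)).
have n_gt0 : 0 < n%:R :> R by rewrite ltr0n (leq_trans _ kn) // ltnW.
have deg_le : #|nbh H g|%:R <= n%:R :> R by rewrite ler_nat -cV max_card.
have := nbh1 typH cg; rewrite cV ler_norml => /andP[lo _].
have : eps * n%:R <= (rho - 1) / 2 * n%:R by rewrite ler_wpM2r // ltW.
have : 0 < (rho - 1) / 2 * n%:R by rewrite mulr_gt0 //; lra.
lra.
Qed.
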